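(* Let $\mu\in(0,1]$. Choose $$K=\left\lceil\frac{2\sqrt3}{\theta_0}\sqrt{1+\frac1\mu}-\frac{2}{\theta_0}+1\right\rceil,\qquad \sigma=\frac{1}{1+m_K(\mu)}.$$ Then the iterates $(x_k)$ of the algorithm APPROX+restart with parameters $K$ and $\sigma$ (as defined in the context) satisfy, for any $k\ge K$, $$\mathbf{E}[\Delta(x_k)]\le\left(1-\min\left(\frac{\mu_F(v)}{\mu},1\right)\frac{1+\mu\theta_0}{2+\mu}\right)^{\frac{k\theta_0\sqrt\mu}{2\sqrt3\sqrt{1+\mu}}-1}\Delta(x_0).$$
   Context: Problem: $f:\mathbb{R}^n\to\mathbb{R}$ is convex and differentiable; $\psi(x)=\sum_{i=1}^n\psi^i(x^i)$ where each $\psi^i:\mathbb{R}\to\mathbb{R}\cup\{+\infty\}$ is closed and convex; $F=f+\psi$; $x_*$ is a minimizer of $F$; $\operatorname{dom}\psi=\{x:\psi(x)<+\infty\}$. For a vector $v$ with positive entries, $\|x\|_v^2=\sum_{i=1}^n v_i(x^i)^2$. Strong convexity assumption: $\mu_F(v)>0$ is a constant such that $F(x)\ge F(x_* )+\frac{\mu_F(v)}{2}\|x-x_*\|_v^2$ for all $x\in\mathbb{R}^n$. Sampling: $\hat S$ is a random subset of $\{1,\dots,n\}$ with $\mathbf{P}(i\in\hat S)=\mathbf{P}(j\in\hat S)$ for all $i,j$, and $\tau=\mathbf{E}[|\hat S|]>0$. ESO assumption: for all $x,h\in\mathbb{R}^n$, $\mathbf{E}[f(x+h_{[\hat S]})]\le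 f(x)+\frac{\tau}{n}\left(\langle\nabla f(x),h\rangle+\frac12\|h\|_v^2\right)$, where $h_{[S]}=\sum_{i\in S}h^ie_i$ and $e_i$ is the $i$th standard basis vector. Reference sequence and coefficients: $\vartheta_0=\theta_0=\tau/n$, $\vartheta_{j+1}=\frac{\sqrt{\vartheta_j^4+4\vartheta_j^2}-\vartheta_j^2}{2}$, and $\frac{1}{\vartheta_{-1}^2}:=\frac{1-\vartheta_0}{\vartheta_0^2}$. Set $\gamma_0^0=1$, $\gamma_1^0=0$, $\gamma_1^1=1$, and for $j\ge1$: $\gamma_{j+1}^i=(1-\vartheta_j)\gamma_j^i$ for $i=0,\dots,j-1$; $\gamma_{j+1}^j=\vartheta_j(1-\frac n\tau\vartheta_{j-1})+\frac n\tau(\vartheta_{j-1}-\vartheta_j)$; $\gamma_{j+1}^{j+1}=\frac n\tau\vartheta_j$. For $j\ge1$ let $W_j=\sum_{i=0}^{j-1}\frac{\gamma_j^i}{\vartheta_{i-1}^2}+\frac{1}{\vartheta_0\vartheta_{j-1}}-\frac{1-\vartheta_0}{\vartheta_0^2}$ and $m_j(\mu)=\frac{\mu\theta_0^2}{1+\mu(1-\theta_0)}W_j$. Also $\Delta(x)=\frac{1-\theta_0}{\theta_0^2}(F(x)-F(x_* ))+\frac{1}{2\theta_0^2}\|x-x_*\|_v^2$. Algorithm APPROX+restart (parameters $K\ge1$ integer, $\sigma\in(0,1)$): choose $x_0\in\operatorname{dom}\psi$, $z_0=x_0$, $\theta_0=\tau/n$, last restart index $s=0$. For $k=0,1,2,\dots$: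 (1) $y_k=(1-\theta_k)x_k+\theta_kz_k$; (2) draw $S_k\sim\hat S$ independently of the past; for $i\in S_k$ set $z_{k+1}^i=\arg\min_{z\in\mathbb{R}}\{\langle\nabla_if(y_k),z-y_k^i\rangle+\frac{\theta_knv_i}{2\tau}|z-z_k^i|^2+\psi^i(z)\}$ ($\nabla_i f$ is the $i$th partial derivative), and $z_{k+1}^i=z_k^i$ for $i\notin S_k$; (3) $x_{k+1}=y_k+\frac n\tau\theta_k(z_{k+1}-z_k)$; (4) $\theta_{k+1}=\frac{\sqrt{\theta_k^4+4\theta_k^2}-\theta_k^2}{2}$; (5) if $k\equiv0\bmod K$, restart: with $j=k+1-s$ (number of iterations since the last restart) put $\mathring x_{k+1}=\frac{1}{W_j}\left(\sum_{i=0}^{j-1}\frac{\gamma_j^i}{\vartheta_{i-1}^2}x_{s+i}+\left(\frac{1}{\vartheta_0\vartheta_{j-1}}-\frac{1-\vartheta_0}{\vartheta_0^2}\right)x_{k+1}\right)$ and $\bar x_{k+1}=\sigma x_{k+1}+(1-\sigma)\mathring x_{k+1}$, then replace $x_{k+1}\leftarrow\bar x_{k+1}$, $z_{k+1}\leftarrow\bar x_{k+1}$, $\theta_{k+1}\leftarrow\theta_0$, $s\leftarrow k+1$. The iterate $x_k$ denotes the value after any such replacement. *)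

(* Defs.v *)
From HB Require Import structures.
From mathcomp Require Import all_boot all_order all_algebra finmap.
From mathcomp Require Import all_classical all_reals all_analysis.

Set Implicit Arguments.
Unset Strict Implicit.
Unset Printing Implicit Defensive.

Import Order.TTheory GRing.Theory Num.Theory.
Import numFieldNormedType.Exports.

Local Open Scope classical_set_scope.
Local Open Scope ring_scope.

(* {set I} with its discrete sigma-algebra, so that random subsets are random
   variables. *)
HB.instance Definition _ (I : finType) :=
  isPointed.Build {set I} (finset.set0 : {set I}).
HB.instance Definition _ (I : finType) :=
  @isMeasurable.Build default_measure_display {set I}
    discrete_measurable discrete_measurable0
    discrete_measurableC discrete_measurableU.

Section extended_functions.
Variable R : realType.
Local Open Scope ereal_scope.

Definition epigraph (g : R -> \bar R) : set (R * R) :=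
  [set p | g p.1 <= p.2%:E].

Definition closed_function (g : R -> \bar R) : Prop := closed (epigraph g).

(* For functions that avoid -oo; no indeterminate form arises since
   0 * +oo = 0 in \bar R. *)
Definition econvex_function (g : R -> \bar R) : Prop :=
  forall (t x y : R), (0 <= t <= 1)%R ->
    g (t * x + (1 - t) * y)%R <= t%:E * g x + (1 - t)%:E * g y.

Definition is_argmin (T : Type) (g : T -> \bar R) (a : T) : Prop :=
  forall b, g a <= g b.

End extended_functions.

Section composite_objective.
Variables (R : realType) (n : nat).
Implicit Types (f : 'rV[R]_n -> R) (psi : 'I_n -> R -> \bar R).
Implicit Types (v x h g : 'rV[R]_n).

Definition wnorm2 v x : R := \sum_i v 0 i * x 0 i ^+ 2.

Definition separable psi x : \bar R := (\sum_i psi i (x 0%R i))%E.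

Definition edom (G : 'rV[R]_n -> \bar R) : set 'rV[R]_n :=
  [set x | (G x < +oo)%E].

Definition composite f psi x : \bar R := ((f x)%:E + separable psi x)%E.

Definition partial f (i : 'I_n) x : R := 'D_(delta_mx 0 i) f x.

Definition gradient f x : 'rV[R]_n := \row_i partial f i x.

Definition dotrv g h : R := \sum_i g 0 i * h 0 i.

(* The vector h_[S]. *)
Definition restrict h (S : {set 'I_n}) : 'rV[R]_n :=
  \sum_(i in S) h 0 i *: delta_mx 0 i.

Definition Delta (F : 'rV[R]_n -> \bar R) v (theta0 : R) xstar x : \bar R :=
  (((1 - theta0) / theta0 ^+ 2)%:E * (F x - F xstar)
   + ((2 * theta0 ^+ 2)^-1 * wnorm2 v (x - xstar))%:E)%E.

End composite_objective.

Section random_sets.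
Context d (Omega : measurableType d) (R : realType) (P : probability Omega R).
Context (n : nat).

Definition uniform_sampling (Shat : {RV P >-> {set 'I_n}}) : Prop :=
  forall i j : 'I_n,
    P [set w | i \in Shat w] = P [set w | j \in Shat w].

Definition mutually_independent (S : nat -> {RV P >-> {set 'I_n}}) : Prop :=
  forall (J : {fset nat}) (A : nat -> set {set 'I_n}),
    (P (\bigcap_(k in [set` J]) (S k @^-1` A k))
     = \prod_(k <- J) P (S k @^-1` A k))%E.

Definition expected_separable_overapproximation (f : 'rV[R]_n -> R)
    (v : 'rV[R]_n) (tau : R) (Shat : {RV P >-> {set 'I_n}}) : Prop :=
  forall x h : 'rV[R]_n,
    ('E_P[fun w => f (x + restrict h (Shat w))%R] <=
     (f x + tau / n%:R * (dotrv (gradient f x) h + 2^-1 * wnorm2 v h))%:E)%E.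

End random_sets.

Section coefficients.
Variables (R : realType) (n : nat) (tau : R).

Definition theta_next (t : R) : R :=
  (Num.sqrt (t ^+ 4 + 4 * t ^+ 2) - t ^+ 2) / 2.

Definition theta0 : R := tau / n%:R.

Definition vartheta (j : nat) : R := iter j theta_next theta0.

(* 1 / vartheta_{i-1}^2, where the value at i = 0 is a convention. *)
Definition inv_vartheta2_prev (i : nat) : R :=
  if i is i'.+1 then (vartheta i' ^+ 2)^-1
  else (1 - vartheta 0) / vartheta 0 ^+ 2.

(* gamma j i is the coefficient with lower index j and upper index i; it is
   extended by 0 to i > j. *)
Fixpoint gamma (j i : nat) : R :=
  match j with
  | 0 => (i == 0)%:R
  | j'.+1 =>
    match j' with
    | 0 => (i == 1)%:R
    | p.+1 =>
      if (i < j')%N then (1 - vartheta j') * gamma j' i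
      else if i == j' then
        vartheta j' * (1 - n%:R / tau * vartheta p)
        + n%:R / tau * (vartheta p - vartheta j')
      else if i == j'.+1 then n%:R / tau * vartheta j'
      else 0
    end
  end.

(* The weight of the last iterate, for j >= 1. *)
Definition last_weight (j : nat) : R :=
  (vartheta 0 * vartheta j.-1)^-1 - (1 - vartheta 0) / vartheta 0 ^+ 2.

Definition W_coef (j : nat) : R :=
  \sum_(i < j) gamma j i * inv_vartheta2_prev i + last_weight j.

Definition m_coef (j : nat) (mu : R) : R :=
  mu * theta0 ^+ 2 / (1 + mu * (1 - theta0)) * W_coef j.

End coefficients.

Section approx_restart.
Variables (R : realType) (n : nat) (f : 'rV[R]_n -> R)
  (psi : 'I_n -> R -> \bar R) (v : 'rV[R]_n) (tau : R) (K : nat) (sigma : R).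

(* Values of theta_k and of the last restart index s at the start of
   iteration k; iteration k ends with a restart exactly when K divides k. *)
Fixpoint theta_restart (k : nat) : R :=
  if k is k'.+1 then
    if (K %| k')%N then theta0 n tau else theta_next (theta_restart k')
  else theta0 n tau.

Fixpoint last_restart (k : nat) : nat :=
  if k is k'.+1 then
    if (K %| k')%N then k'.+1 else last_restart k'
  else 0.

Definition prox_objective (theta : R) (y z : 'rV[R]_n) (i : 'I_n) (t : R)
    : \bar R :=
  ((partial f i y * (t - y 0 i)
    + theta * n%:R * v 0 i / (2 * tau) * `|t - z 0 i| ^+ 2)%:E
   + psi i t)%E.

(* [approx_restart x0 S x z zp] : on the realization S of the samplings, x and
   z are the iterates of the algorithm, after any replacement by a restart;
   zp k is the value given to z_{k+1} by iteration k before any such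
   replacement. *)
Record approx_restart (x0 : 'rV[R]_n) (S : nat -> {set 'I_n})
    (x z zp : nat -> 'rV[R]_n) : Prop := ApproxRestart {
  ar_x0 : x 0%N = x0 ;
  ar_z0 : z 0%N = x0 ;
  ar_step : forall k,
    let th := theta_restart k in
    let s := last_restart k in
    let j := (k.+1 - s)%N in
    let y := (1 - th) *: x k + th *: z k in
    let xp := y + (n%:R / tau * th) *: (zp k - z k) in
    let xring := (W_coef n tau j)^-1 *:
      (\sum_(i < j) (gamma n tau j i * inv_vartheta2_prev n tau i)
                      *: x (s + i)%N
       + last_weight n tau j *: xp) in
    let xbar := sigma *: xp + (1 - sigma) *: xring in
    [/\ forall i, i \in S k ->
          is_argmin (prox_objective th y (z k) i) (zp k 0 i),
        forall i, i \notin S k -> zp k 0 i = z k 0 i,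
        x k.+1 = (if (K %| k)%N then xbar else xp) &
        z k.+1 = (if (K %| k)%N then xbar else zp k)] }.

End approx_restart.

(* Main.v *)
Require Import Defs.
From HB Require Import structures.
From mathcomp Require Import all_boot all_order all_algebra finmap.
From mathcomp Require Import all_classical all_reals all_analysis.
From mathcomp Require Import ring lra.

Set Implicit Arguments.
Unset Strict Implicit.
Unset Printing Implicit Defensive.

Import Order.TTheory GRing.Theory Num.Theory.
Import numFieldNormedType.Exports.

Local Open Scope classical_set_scope.
Local Open Scope ring_scope.

#[local] Arguments gamma : simpl never.
#[local] Arguments vartheta : simpl never.

(* Write Fmin = F(xstar).  Between two restarts, the Lyapunov function
     (fhat_k - Fmin) / vartheta_{k-1}^2 + |z_k - xstar|_v^2 / (2 theta0^2),
   where fhat_k = f(x_k) + sum_i gamma_k^i psi(z_i) >= F(x_k), is a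
   supermartingale whose value at a restart point x_s is Delta(x_s).
   As x_k = sum_i gamma_k^i z_i is a convex combination, averaging these bounds
   with the weights gamma_k^i yields
     E Delta(x_k) + W_k E (F(xring_k) - Fmin) <= E Delta(x_s),
   and also E Delta(xring_k) <= E Delta(x_s).  Strong convexity bounds the
   fraction min(muF / mu, 1) of (1 - sigma) Delta(xring_K) by
   sigma W_K (F(xring_K) - Fmin), so a phase of length K contracts E Delta by
   1 - min(muF / mu, 1) (1 - sigma), while other phases do not increase it.
   The choice of K gives theta0^2 W_K >= 1 / mu + theta0, because
   sum_i gamma_k^i / vartheta_{i-1}^2 >= 1 / (3 vartheta_{k-1}^2) and
   1 / vartheta_k >= (k + 2 / theta0) / 2.  The restart points are x_1, x_{K+1},
   x_{2K+1} and so on, hence at least k / K - 1 phases of length K are complete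
   before k.
   Every iterate is a function of the finitely many possible sampling histories,
   so all expectations are finite sums. *)

(** * The recursion that generates the step parameters *)

Section theta_next_facts.
Variable R : realType.
Implicit Type t : R.

(** [theta_next t] is the larger root of the quadratic equation u^2 + t^2 u = t^2. *)
Lemma theta_next_root t :
  theta_next t ^+ 2 = (1 - theta_next t) * t ^+ 2.
Proof.
have h : 0 <= t ^+ 4 + 4 * t ^+ 2.
  by rewrite addr_ge0 ?exprn_even_ge0 // mulr_ge0 ?sqr_ge0.
have := sqr_sqrtr h; rewrite /theta_next; move: (Num.sqrt _) => s hs.
have -> : ((s - t ^+ 2) / 2) ^+ 2 = (s ^+ 2 - 2 * s * t ^+ 2 + t ^+ 4) / 4.
  by field.
by rewrite hs; field.
Qed.

Lemma theta_next_gt0 t : 0 < t -> 0 < theta_next t.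
Proof.
move=> t0; rewrite /theta_next divr_gt0 // subr_gt0.
have h : 0 < 4 * t ^+ 2 by rewrite mulr_gt0 ?exprn_gt0 ?ltr0n.
have h' : 0 <= t ^+ 4 by rewrite exprn_ge0 // ltW.
rewrite -ltr_sqr ?nnegrE ?sqrtr_ge0 ?sqr_ge0 // sqr_sqrtr; last first.
  by rewrite addr_ge0 // ltW.
by rewrite -exprM ltrDl.
Qed.

Lemma theta_next_le t : 0 < t -> theta_next t <= t.
Proof.
move=> t0; have := theta_next_root t; have := theta_next_gt0 t0.
move: (theta_next t) => u u0 hu.
have : u ^+ 2 <= t ^+ 2.
  by rewrite hu ler_piMl ?sqr_ge0 // gerBl ltW.
by rewrite ler_sqr ?nnegrE; [ | exact: ltW..].
Qed.

(** With a = 1 / [theta_next t] and b = 1 / t the quadratic equation reads a^2 - a = b^2, so (a -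
    1/2)^2 = b^2 + 1/4 exceeds b^2. Since a (a - 1) = b^2 > 0, also a > 1, which settles the sign
    when taking roots. *)
Lemma theta_next_inv t : 0 < t -> t^-1 + 2^-1 <= (theta_next t)^-1.
Proof.
move=> t0; have := theta_next_root t; have := theta_next_gt0 t0.
move: (theta_next t) => u u0 hu.
have hV : u^-1 ^+ 2 - u^-1 = t^-1 ^+ 2.
  have u1 : u != 0 by rewrite gt_eqF.
  have t1 : t != 0 by rewrite gt_eqF.
  have e : 1 - u = u ^+ 2 / t ^+ 2 by rewrite hu mulfK // expf_neq0.
  have -> : u^-1 ^+ 2 - u^-1 = (1 - u) / u ^+ 2 by field.
  by rewrite e; field; rewrite u1 t1.
have uV : 0 < u^-1 by rewrite invr_gt0.
have tV : 0 < t^-1 by rewrite invr_gt0.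
move: hV uV tV; move: (u^-1) (t^-1) => a b hab a0 b0.
have a1 : 0 < a - 1.
  by rewrite -(pmulr_rgt0 _ a0) mulrBr mulr1 -expr2 hab exprn_gt0.
have : b ^+ 2 <= (a - 2^-1) ^+ 2 by rewrite -hab; lra.
rewrite ler_sqr ?nnegrE; lra.
Qed.

End theta_next_facts.

(** * The coefficients gamma, their sign, their sums and the total weight W *)

Section coefficient_facts.
Variables (R : realType) (n : nat) (tau : R).
Hypotheses (theta0_gt0 : 0 < theta0 n tau) (theta0_le1 : theta0 n tau <= 1).

Local Notation T0 := (theta0 n tau).
Local Notation vt := (vartheta n tau).
Local Notation a := (inv_vartheta2_prev n tau).
Local Notation gam := (gamma n tau).

Lemma theta0V : n%:R / tau = T0^-1.
Proof. by rewrite /theta0 invf_div. Qed.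

Lemma vartheta0 : vt 0 = T0.
Proof. by []. Qed.

Lemma vartheta_gt0 j : 0 < vt j.
Proof. by elim: j => [|j ih] //=; exact: theta_next_gt0. Qed.

Lemma vartheta_neq0 j : vt j != 0.
Proof. by rewrite gt_eqF ?vartheta_gt0. Qed.

Lemma varthetaS_le j : vt j.+1 <= vt j.
Proof. exact/theta_next_le/vartheta_gt0. Qed.

Lemma vartheta_le_theta0 j : vt j <= T0.
Proof. by elim: j => [//|j]; exact/le_trans/varthetaS_le. Qed.

Lemma vartheta_le1 j : vt j <= 1.
Proof. exact: le_trans (vartheta_le_theta0 j) _. Qed.

Lemma inv_vartheta2_prev_ge0 j : 0 <= a j.
Proof.
case: j => [|j] /=; last by rewrite invr_ge0 sqr_ge0.
by rewrite divr_ge0 ?sqr_ge0 // subr_ge0.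
Qed.

(** For j >= 1 this is the quadratic equation of [theta_next]; the convention for 1 /
    vartheta_{-1}^2 extends it to j = 0. *)
Lemma inv_vartheta2_prevS j : a j = (1 - vt j) * a j.+1.
Proof.
case: j => [//|j]; rewrite /inv_vartheta2_prev.
have e : vt j.+1 ^+ 2 = (1 - vt j.+1) * vt j ^+ 2 := theta_next_root _.
have h0 := vartheta_neq0 j; have h1 := vartheta_neq0 j.+1.
have h2 : 1 - vt j.+1 != 0.
  apply: contra_neq h1 => h2; apply/eqP; move/eqP: e.
  by rewrite h2 mul0r sqrf_eq0.
by rewrite e; field; rewrite h0 h2.
Qed.

Lemma inv_vartheta2_prevB j : a j.+1 - a j = (vt j)^-1.
Proof.
by rewrite (inv_vartheta2_prevS j) /=; have := vartheta_neq0 j => h; field.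
Qed.

Lemma gammaSS j i : gam j.+2 i =
  if (i < j.+1)%N then (1 - vt j.+1) * gam j.+1 i
      else if i == j.+1 then
        vt j.+1 * (1 - T0^-1 * vt j) + T0^-1 * (vt j - vt j.+1)
      else if i == j.+2 then T0^-1 * vt j.+1
      else 0.
Proof. by rewrite -theta0V. Qed.

Lemma gamma_diag j : gam j.+1 j.+1 = T0^-1 * vt j.
Proof.
case: j => [|j]; first by rewrite /gamma /vartheta /= mulVf ?gt_eqF.
by rewrite gammaSS ltnNge leqnSn /= eqn_leq ltnn /= eqxx.
Qed.

(** The only delicate entry is the next-to-last one of a row: both of its terms are nonnegative
    because [vartheta] is nonincreasing and bounded by T0. *)
Lemma gamma_ge0 j i : 0 <= gam j i.
Proof.
elim: j i => [i|[|j] ih i]; [exact: ler0n|exact: ler0n|rewrite gammaSS].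
case: ifP => _; first by rewrite mulr_ge0 ?subr_ge0 ?vartheta_le1.
have T0V : 0 <= T0^-1 by rewrite invr_ge0 ltW.
case: ifP => _; last first.
  by case: ifP => _ //; rewrite mulr_ge0 // ltW ?vartheta_gt0.
rewrite addr_ge0 // mulr_ge0 ?subr_ge0 ?varthetaS_le ?(ltW (vartheta_gt0 _)) //.
by rewrite mulrC ler_pdivrMr // mul1r vartheta_le_theta0.
Qed.

(* The recursion satisfied by the coordinates of x_k when they are expanded on
   those of z_0, ..., z_k. *)
Lemma sum_gammaS (c : nat -> R) j :
  \sum_(i < j.+2) gam j.+1 i * c i =
  (1 - vt j) * (\sum_(i < j.+1) gam j i * c i) + vt j * c j
  + T0^-1 * vt j * (c j.+1 - c j).
Proof.
case: j => [|j].
  rewrite !big_ord_recl !big_ord0 /gamma vartheta0 /=.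
  have h : T0 != 0 by rewrite gt_eqF.
  by rewrite /bump /=; field.
rewrite big_ord_recr big_ord_recr /= gamma_diag.
rewrite [in RHS]big_ord_recr /= gamma_diag.
under eq_bigr => i _ do rewrite gammaSS ltn_ord -mulrA.
rewrite -mulr_sumr gammaSS ltnn eqxx.
by move: (\sum_(i < _) _) => s; ring.
Qed.

Lemma sum_gamma1 j : \sum_(i < j.+1) gam j i = 1.
Proof.
elim: j => [|j ih]; first by rewrite big_ord1.
have := sum_gammaS (fun=> 1) j.
under eq_bigr do rewrite mulr1.
under [in RHS]eq_bigr do rewrite mulr1.
by move=> ->; rewrite ih; ring.
Qed.

Lemma last_weight_gt0 j : 0 < last_weight n tau j.
Proof.
rewrite /last_weight vartheta0 subr_gt0.
have h : T0^-1 <= (vt j.-1)^-1.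
  by rewrite lef_pV2 ?posrE ?vartheta_gt0 // vartheta_le_theta0.
have TV : 0 <= T0^-1 by rewrite invr_ge0 ltW.
rewrite (invfM T0 (vt _)); have := ler_wpM2l TV h; apply: lt_le_trans.
by rewrite -expr2 exprVn gtr_pMl ?invr_gt0 ?exprn_gt0 // gtrBl.
Qed.

(** The diagonal coefficient satisfies gamma a = (vartheta_j / T0) / vartheta_j^2 = 1 / (T0
    vartheta_j), which is the first term of [last_weight]; the last iterate is thus absorbed into
    the sum. *)
Lemma W_coefE j : W_coef n tau j.+1 =
  \sum_(i < j.+2) gam j.+1 i * a i - (1 - T0) / T0 ^+ 2.
Proof.
rewrite /W_coef [in RHS]big_ord_recr /= gamma_diag /last_weight.
rewrite /= -addrA; congr (_ + (_ - _)).
rewrite vartheta0.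
have h := vartheta_neq0 j; have h' : T0 != 0 by rewrite gt_eqF.
by field; rewrite h h'.
Qed.

Lemma W_coef_gt0 j : 0 < W_coef n tau j.+1.
Proof.
rewrite ltr_wpDl ?last_weight_gt0 // sumr_ge0 // => i _.
by rewrite mulr_ge0 ?gamma_ge0 ?inv_vartheta2_prev_ge0.
Qed.

(** Let s_j be the sum and w = 1 / vartheta_j. As vartheta_j a_j = w - 1 and a_{j+1} - a_j = w,
    [sum_gammaS] gives s_{j+1} = (1 - vartheta_j) s_j + (w - 1) + 1 / T0. The induction hypothesis
    bounds the first term below by a_j / 3 - (w - 1) / 3, and 1 / T0 >= 1 leaves enough for w /
    3. *)
Lemma sum_gamma_inv_ge j : a j / 3 <= \sum_(i < j.+1) gam j i * a i.
Proof.
elim: j => [|j ih].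
  rewrite big_ord1 mul1r ler_pdivrMr // ler_peMr ?inv_vartheta2_prev_ge0 //.
  by rewrite ler1n.
rewrite sum_gammaS inv_vartheta2_prevB.
have h0 := vartheta_gt0 j; have h1 := vartheta_le1 j.
have e1 : vt j * a j = (vt j)^-1 - 1.
  by rewrite (inv_vartheta2_prevS j) /=; have := vartheta_neq0 j => h; field.
have e2 : a j.+1 = a j + (vt j)^-1 by rewrite -inv_vartheta2_prevB addrC subrK.
have e3 : T0^-1 * vt j / vt j = T0^-1 by rewrite mulfK ?vartheta_neq0.
rewrite e3 e2.
have T0V : 1 <= T0^-1 by rewrite invf_ge1.
have vV : 1 <= (vt j)^-1 by rewrite invf_ge1.
have := ler_wpM2l (_ : 0 <= 1 - vt j) ih; rewrite subr_ge0 => /(_ h1).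
move: (\sum_(i < _) _) (a j) e1 => s aj e1.
move: (vt j)^-1 e1 vV => w e1 vV.
have -> : (1 - vt j) * (aj / 3) = aj / 3 - (vt j * aj) / 3 by ring.
lra.
Qed.

Lemma vartheta_inv_ge j : (j%:R + 2 / T0) / 2 <= (vt j)^-1.
Proof.
elim: j => [|j ih].
  by rewrite add0r mulrAC mulfV // mul1r.
have := theta_next_inv (vartheta_gt0 j).
change (theta_next (vt j)) with (vt j.+1).
by rewrite -[j.+1%:R]natr1; lra.
Qed.

End coefficient_facts.

(** * Convexity relative to a domain, and Jensen's inequality *)

Section convex_on.
Variables (R : realType) (V : lmodType R).

(** The pair [D], [phi] encodes an extended-real convex function by its domain and its finite
    values, so that all estimates take place in [R]. *)
Definition convex_on (D : V -> Prop) (phi : V -> R) : Prop :=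
  forall (t : R) (x y : V), 0 <= t <= 1 -> D x -> D y ->
    D (t *: x + (1 - t) *: y) /\
    phi (t *: x + (1 - t) *: y) <= t * phi x + (1 - t) * phi y.

(** The weights are left unnormalized because it is applied both to the gammas, of total 1, and to
    the ring weights, of total W. *)
Lemma convex_on_jensen (D : V -> Prop) (phi : V -> R) (w : nat -> R)
    (c : nat -> V) (m : nat) : convex_on D phi ->
  (forall i, (i < m)%N -> 0 <= w i) -> (forall i, (i < m)%N -> D (c i)) ->
  let W := \sum_(i < m) w i in 0 < W ->
  D (W^-1 *: \sum_(i < m) w i *: c i) /\
  phi (W^-1 *: \sum_(i < m) w i *: c i) <= W^-1 * \sum_(i < m) w i * phi (c i).
Proof.
move=> cvx; elim: m => [|m ih] w0 cD /=; first by rewrite big_ord0 ltxx.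
have wlt i : (i < m)%N -> 0 <= w i by move=> im; rewrite w0 // ltnW.
have Wm0 : 0 <= \sum_(i < m) w i by rewrite sumr_ge0 // => i _; rewrite wlt.
rewrite !big_ord_recr /=.
(* If the earlier weights sum to zero, they all vanish and the average is the last point; otherwise
   the last point is merged with the average of the earlier ones. *)
have [W0 wm|Wn0] := eqVneq (\sum_(i < m) w i) 0.
  have wi0 (i : 'I_m) : w i = 0.
    have /eqP := W0; rewrite psumr_eq0 => [|j _]; last by rewrite wlt.
    by move/allP/(_ i (mem_index_enum i))/eqP.
  rewrite W0 add0r in wm *; have wn0 : w m != 0 by rewrite gt_eqF.
  rewrite !big1 ?add0r; last 2 first.
  - by move=> i _; rewrite wi0 mul0r.
  - by move=> i _; rewrite wi0 scale0r.
  by rewrite scalerA mulrA mulVf // scale1r mul1r; split=> //; exact: cD.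
have Wpos : 0 < \sum_(i < m) w i by rewrite lt_neqAle eq_sym Wn0.
have cDlt i : (i < m)%N -> D (c i) by move=> im; apply: cD; rewrite ltnW.
have {ih} [] := ih wlt cDlt Wpos.
move: (\sum_(i < m) w i *: c i) (\sum_(i < m) w i * phi (c i)) Wpos.
move: (\sum_(i < m) w i) => W C p Wpos DC phiC W'pos.
have wm0 : 0 <= w m by exact: w0.
have Wn : W != 0 by rewrite gt_eqF.
have W'n : W + w m != 0 by rewrite gt_eqF.
have t01 : 0 <= W / (W + w m) <= 1.
  by rewrite ler_pdivrMr // mul1r lerDl wm0 divr_ge0 // ltW.
have [D' phi'] := cvx _ _ _ t01 DC (cD m (ltnSn m)).
have e : (W / (W + w m)) *: (W^-1 *: C) + (1 - W / (W + w m)) *: c m =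
         (W + w m)^-1 *: (C + w m *: c m).
  rewrite scalerDr !scalerA; congr (_ *: _ + _ *: _).
    by field; rewrite Wn W'n.
  by field.
rewrite e in D' phi'; split=> //; apply: le_trans phi' _.
have -> : (W + w m)^-1 * (p + w m * phi (c m)) =
  W / (W + w m) * (W^-1 * p) + (1 - W / (W + w m)) * phi (c m).
  by field; rewrite Wn W'n.
by rewrite lerD2r ler_wpM2l //; case/andP: t01.
Qed.

Lemma convex_onD (D1 D2 : V -> Prop) (phi1 phi2 : V -> R) :
  convex_on D1 phi1 -> convex_on D2 phi2 ->
  convex_on (fun x => D1 x /\ D2 x) (fun x => phi1 x + phi2 x).
Proof.
move=> c1 c2 t x y t01 [x1 x2] [y1 y2].
have [d1 p1] := c1 _ _ _ t01 x1 y1; have [d2 p2] := c2 _ _ _ t01 x2 y2.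
by split=> //; rewrite !mulrDr addrACA lerD.
Qed.

Lemma convex_onZ (D : V -> Prop) (phi : V -> R) (k : R) : 0 <= k ->
  convex_on D phi -> convex_on D (fun x => k * phi x).
Proof.
move=> k0 c t x y t01 Dx Dy; have [d p] := c _ _ _ t01 Dx Dy; split=> //.
by rewrite (le_trans (ler_wpM2l k0 p)) // mulrDr !(mulrCA k).
Qed.

Lemma convex_on_sum (I : finType) (D : I -> V -> Prop) (phi : I -> V -> R) :
  (forall i, convex_on (D i) (phi i)) ->
  convex_on (fun x => forall i, D i x) (fun x => \sum_i phi i x).
Proof.
move=> c t x y t01 Dx Dy; split.
  by move=> i; have [] := c i _ _ _ t01 (Dx i) (Dy i).
rewrite !mulr_sumr -big_split ler_sum // => i _.
by have [] := c i _ _ _ t01 (Dx i) (Dy i).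
Qed.

End convex_on.

(** * One-dimensional proximal steps *)

Section scalar_convexity.
Variable R : realType.

Lemma convex_on_sqr (b : R) :
  convex_on (fun=> True) (fun x : R^o => (x - b) ^+ 2 : R).
Proof.
move=> t x y /andP[t0 t1] _ _; split=> //; rewrite /GRing.scale /= -subr_ge0.
have -> : t * (x - b) ^+ 2 + (1 - t) * (y - b) ^+ 2
    - (t * x + (1 - t) * y - b) ^+ 2 = t * (1 - t) * (x - y) ^+ 2 by ring.
by rewrite mulr_ge0 ?sqr_ge0 // mulr_ge0 // subr_ge0.
Qed.

Lemma convex_on_efun (g : R -> \bar R) :
  (forall t, g t != -oo%E) -> econvex_function g ->
  convex_on (fun t : R^o => (g t < +oo)%E) (fun t : R^o => fine (g t)).
Proof.
move=> gN gc t x y t01 gx gy; rewrite /GRing.scale /=.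
have fx : g x \is a fin_num by rewrite fin_numE gN /= lt_eqF.
have fy : g y \is a fin_num by rewrite fin_numE gN /= lt_eqF.
have := gc _ x y t01; rewrite -(fineK fx) -(fineK fy) -!EFinM -EFinD => h.
have gxy : (g (t * x + (1 - t) * y)%R < +oo)%E.
  by rewrite (le_lt_trans h) // ltry.
split=> //; rewrite -lee_fin !fineK //.
by rewrite fin_numE gN /= lt_eqF.
Qed.

(* Minimality of [a] along the segment from [a] to [u], together with the
   strong convexity of the quadratic term. *)
Lemma prox_three_point (D : R -> Prop) (phi : R -> R) (g C y z a u : R) :
  convex_on (D : R^o -> Prop) phi -> D a -> D u ->
  let p t := g * (t - y) + C * (t - z) ^+ 2 + phi t in
  (forall b, D b -> p a <= p b) ->
  p a + C * (u - a) ^+ 2 <= p u.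
Proof.
move=> cvx Da Du p pmin.
have seg t : 0 < t <= 1 -> C * (u - a) ^+ 2 * (1 - t) <= p u - p a.
  move=> /andP[t0 t1]; have t01 : 0 <= t <= 1 by rewrite t1 ltW.
  have [Dt pt] := cvx _ _ _ t01 Du Da.
  have := pmin _ Dt; rewrite /p /GRing.scale /= in pt *.
  move=> h; rewrite -subr_ge0 -(pmulr_rge0 _ t0).
  set s := t * u + (1 - t) * a in pt h.
  have -> : t * (g * (u - y) + C * (u - z) ^+ 2 + phi u -
        (g * (a - y) + C * (a - z) ^+ 2 + phi a) - C * (u - a) ^+ 2 * (1 - t)) =
      g * (s - y) + C * (s - z) ^+ 2 + (t * phi u + (1 - t) * phi a) -
        (g * (a - y) + C * (a - z) ^+ 2 + phi a).
    by rewrite /s; ring.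
  by rewrite subr_ge0 (le_trans h) // lerD2l.
set Q := C * _ in seg *; have pu := pmin _ Du.
rewrite -lerBrDl leNgt; apply/negP => lt.
have Q0 : 0 < Q by apply: le_lt_trans lt; rewrite subr_ge0.
have r0 : 0 <= p u - p a by rewrite subr_ge0.
(* Instead of letting t tend to 0, one value of t suffices: if r < Q, this t makes Q (1 - t) equal
   to the midpoint (Q + r) / 2, which exceeds r and contradicts [seg]. *)
move: (p u - p a) r0 lt seg => r r0 lt /(_ ((Q - r) / (2 * Q))).
have -> : Q * (1 - (Q - r) / (2 * Q)) = (Q + r) / 2 by field; rewrite gt_eqF.
have Q2 : 0 < 2 * Q by rewrite mulr_gt0.
rewrite ler_pdivrMr // divr_gt0 ?subr_gt0 //= => h.
have : Q - r <= 1 * (2 * Q) by lra.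
by move=> /h; lra.
Qed.

(** The algorithm only says that a proximal point is some minimizer; uniqueness is what makes the
    iterates functions of the sampling history. *)
Lemma prox_unique (D : R -> Prop) (phi : R -> R) (g C y z a b : R) :
  0 < C -> convex_on (D : R^o -> Prop) phi -> D a -> D b ->
  let p t := g * (t - y) + C * (t - z) ^+ 2 + phi t in
  (forall u, D u -> p a <= p u) -> (forall u, D u -> p b <= p u) -> a = b.
Proof.
move=> C0 cvx Da Db p pa pb.
have := prox_three_point cvx Da Db pa => h.
have : C * (b - a) ^+ 2 <= 0.
  by rewrite -(lerD2l (p a)) addr0 (le_trans h) // pb.
rewrite pmulr_rle0 // => h0.
have : (b - a) ^+ 2 == 0 by rewrite eq_le h0 sqr_ge0.
by rewrite sqrf_eq0 subr_eq0 => /eqP.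
Qed.

End scalar_convexity.

(** * The gradient inequality for a differentiable convex function *)

Section convex_gradient.
Variables (R : realType) (n : nat) (f : 'rV[R]_n -> R).

Lemma dotrv_gradient y h :
  differentiable f y -> dotrv (gradient f y) h = 'D_h f y.
Proof.
move=> df; rewrite deriveE // [in RHS](row_sum_delta h) raddf_sum.
apply: eq_bigr => i _; rewrite mxE /partial deriveE // mulrC.
exact: esym (linearZ_LR ('d f y) (h 0 i) (delta_mx 0 i)).
Qed.

Lemma convex_on_function : convex_function [set: convex_lmodType 'rV[R]_n] f ->
  convex_on (fun=> True) f.
Proof.
move=> cf t x y /andP[t0 t1] _ _; split=> //.
have t01 : (Itv.spec (@Itv.num_sem R) (Itv.Real `[0%Z, 1%Z]) t).
  by rewrite /= /Itv.num_sem /= num_real !in_itv /= t0 t1.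
by have := cf (Itv.mk t01) x y (in_setT _) (in_setT _).
Qed.

(** By convexity the difference quotient at y along x - y is at most f x - f y for every step in (0,
    1]; its limit from the right is the directional derivative. *)
Lemma convex_gradient_le x y :
  convex_function [set: convex_lmodType 'rV[R]_n] f -> differentiable f y ->
  f y + dotrv (gradient f y) (x - y) <= f x.
Proof.
move=> /convex_on_function cf df; rewrite dotrv_gradient // -lerBrDl.
have dv : derivable f y (x - y) by exact: diff_derivable.
have cv : h^-1 *: (f (h *: (x - y) + y) - f y) @[h --> 0^'+] --> 'D_(x - y) f y.
  by apply: cvg_dnbhs_at_right; exact: dv.
apply: (cvgr_to_le cv); near=> t.
have t0 : 0 < t by near: t; exact: nbhs_right_gt.
have t1 : t <= 1 by near: t; apply: nbhs_right_le.
have t01 : 0 <= t <= 1 by rewrite t1 ltW.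
have [_] := cf _ x y t01 I I.
have -> : t *: x + (1 - t) *: y = t *: (x - y) + y.
  by rewrite scalerBr scalerBl scale1r addrCA addrC.
move=> h; rewrite /GRing.scale /= mulrC ler_pdivrMr //.
by lra.
Unshelve. all: by end_near. Qed.

End convex_gradient.

(** * One iteration in expectation over a single sampling *)

Section one_step.
Variables (R : realType) (n : nat) (f : 'rV[R]_n -> R).
Variables (psi : 'I_n -> R -> \bar R) (v : 'rV[R]_n) (tau : R).
Hypothesis psiN : forall i t, psi i t != -oo%E.
Hypothesis psi_cvx : forall i, econvex_function (psi i).

Local Notation T0 := (theta0 n tau).

Definition in_dom (x : 'rV[R]_n) : Prop := forall i, (psi i (x 0%R i) < +oo)%E.

(** [fine] sends +oo to 0, so this and [F_real] are faithful on [in_dom] only; every point used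
    later is shown to lie there. *)
Definition psi_real (x : 'rV[R]_n) : R := \sum_i fine (psi i (x 0 i)).

Definition F_real (x : 'rV[R]_n) : R := f x + psi_real x.

Lemma psi_fin i t : (psi i t < +oo)%E -> psi i t \is a fin_num.
Proof. by move=> h; rewrite fin_numE psiN lt_eqF. Qed.

Lemma separable_real x : in_dom x -> separable psi x = (psi_real x)%:E.
Proof.
move=> dx; rewrite /separable /psi_real -sumEFin; apply: eq_bigr => i _.
by rewrite fineK // psi_fin.
Qed.

Lemma separable_lty x : (separable psi x < +oo)%E -> in_dom x.
Proof.
move=> h i; rewrite ltey; apply: contraTneq h => e.
rewrite -leNgt leye_eq; apply/eqP/esum_eqyP; last by exists i.
by move=> j _; exact: psiN.
Qed.

Lemma composite_real x : in_dom x -> composite f psi x = (F_real x)%:E.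
Proof. by move=> dx; rewrite /composite separable_real. Qed.

Definition prox_real (th : R) (y z : 'rV[R]_n) (i : 'I_n) (t : R) : R :=
  partial f i y * (t - y 0 i)
  + th * n%:R * v 0 i / (2 * tau) * (t - z 0 i) ^+ 2 + fine (psi i t).

(** The point u certifies that the objective is finite somewhere, which forces its minimum to be
    finite. *)
Lemma argmin_prox_real th y z i a u :
  (psi i u < +oo)%E -> is_argmin (prox_objective f psi v tau th y z i) a ->
  (psi i a < +oo)%E /\
  forall b, (psi i b < +oo)%E -> prox_real th y z i a <= prox_real th y z i b.
Proof.
have E b : (psi i b < +oo)%E ->
    prox_objective f psi v tau th y z i b = (prox_real th y z i b)%:E.
  move=> h; rewrite /prox_objective /prox_real real_normK ?num_real //.
  by rewrite -{1}(fineK (psi_fin h)).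
move=> hu amin; have ha : (psi i a < +oo)%E.
  have := amin u; rewrite (E u) // /prox_objective => h.
  rewrite ltey; apply: contraTneq h => ->.
  by rewrite addey // -ltNge ltry.
by split=> // b hb; rewrite -lee_fin -!E.
Qed.

Lemma psi_convex_on i :
  convex_on (fun t : R^o => (psi i t < +oo)%E) (fun t : R^o => fine (psi i t)).
Proof. exact: convex_on_efun. Qed.

Lemma wnorm2Z k x : wnorm2 v (k *: x) = k ^+ 2 * wnorm2 v x.
Proof.
by rewrite mulr_sumr; apply: eq_bigr => i _; rewrite mxE exprMn mulrCA.
Qed.

Lemma dotrvDr (g h k : 'rV[R]_n) : dotrv g (h + k) = dotrv g h + dotrv g k.
Proof. by rewrite -big_split; apply: eq_bigr => i _; rewrite mxE mulrDr. Qed.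

Lemma dotrvZr (g : 'rV[R]_n) c h : dotrv g (c *: h) = c * dotrv g h.
Proof. by rewrite mulr_sumr; apply: eq_bigr => i _; rewrite mxE mulrCA. Qed.

Lemma restrictE (h : 'rV[R]_n) (S : {set 'I_n}) (i : 'I_n) :
  Defs.restrict h S 0 i = if i \in S then h 0 i else 0.
Proof.
rewrite /Defs.restrict summxE; case: ifPn => iS.
  rewrite (bigD1 i) //= !mxE !eqxx mulr1 big1 ?addr0 // => j /andP[_ ji].
  by rewrite !mxE eq_sym (negbTE ji) andbF mulr0.
rewrite big1 // => j jS; rewrite !mxE /=.
case: (eqVneq i j) => [e|_]; last by rewrite mulr0.
by rewrite -e (negbTE iS) in jS.
Qed.

Section sampling_weights.
Variable q : {set 'I_n} -> R.
Hypothesis q_sum1 : \sum_S q S = 1.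
Hypothesis q_marginal : forall i : 'I_n,
  \sum_(S : {set 'I_n} | i \in S) q S = T0.

Lemma sampling_mean (a b : 'I_n -> R) :
  \sum_(S : {set 'I_n}) q S * (\sum_(i : 'I_n) if i \in S then a i else b i) =
  \sum_i (T0 * a i + (1 - T0) * b i).
Proof.
under eq_bigr do rewrite mulr_sumr.
rewrite exchange_big; apply: eq_bigr => i _ /=.
have <- : \sum_(S : {set 'I_n} | i \notin S) q S = 1 - T0.
  rewrite -(q_marginal i) -q_sum1.
  rewrite [in RHS](bigID (fun S : {set 'I_n} => i \in S)) /=.
  by rewrite addrAC subrr add0r.
rewrite -(q_marginal i) !mulr_suml (bigID (fun S : {set 'I_n} => i \in S)) /=.
by congr (_ + _); apply: eq_bigr => S h; rewrite ?h ?(negbTE h).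
Qed.

Hypothesis f_cvx : convex_function [set: convex_lmodType 'rV[R]_n] f.
Hypothesis f_diff : forall y, differentiable f y.
Hypothesis T0_gt0 : 0 < T0.
Hypothesis q_eso : forall x h,
  \sum_S q S * f (x + Defs.restrict h S) <=
  f x + T0 * (dotrv (gradient f x) h + 2^-1 * wnorm2 v h).

(** [zt] is the virtual point in which every coordinate is updated, and [zS S] below updates only
    the coordinates in S. [Pk] stands where psi x would be expected; it will be [psi_hat]. *)
Variables (t : R) (x z zt xs : 'rV[R]_n) (Pk : R).
Hypotheses (t_gt0 : 0 < t) (t_le1 : t <= 1).
Hypothesis xs_dom : in_dom xs.

Let y := (1 - t) *: x + t *: z.

Hypothesis zt_argmin : forall i,
  is_argmin (prox_objective f psi v tau t y z i) (zt 0 i).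

Let zS (S : {set 'I_n}) : 'rV[R]_n :=
  \row_i if i \in S then zt 0 i else z 0 i.
Let xS S := y + (T0^-1 * t) *: (zS S - z).

(** Sum of [prox_three_point] over the coordinates, compared with the coordinates of xs. *)
Lemma one_step_prox :
  dotrv (gradient f y) (zt - y) + t / (2 * T0) * wnorm2 v (zt - z)
    + psi_real zt + t / (2 * T0) * wnorm2 v (zt - xs) <=
  dotrv (gradient f y) (xs - y) + t / (2 * T0) * wnorm2 v (z - xs)
    + psi_real xs.
Proof.
rewrite /dotrv /wnorm2 /psi_real !mulr_sumr -!big_split /=.
apply: ler_sum => i _; rewrite !mxE.
have [dz zmin] := argmin_prox_real (xs_dom i) (zt_argmin i).
have := @prox_three_point R (fun t => (psi i t < +oo)%E)
  (fun t => fine (psi i t)) _ _ _ _ _ _ (@psi_convex_on i) dz (xs_dom i) zmin.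
have C : t * n%:R * v 0 i / (2 * tau) = t / (2 * T0) * v 0 i.
  by rewrite /theta0 !invfM invrK; ring.
by rewrite /prox_real C; lra.
Qed.

(** The overapproximation is applied at y with h = (t / T0) (zt - z), so its quadratic term is t^2 /
    (2 T0) times the squared norm of zt - z; t times [one_step_prox] cancels it. The linear terms
    are then bounded by the gradient inequality, at x with weight 1 - t and at xs with weight t. *)
Lemma one_step_objective :
  \sum_S q S * f (xS S) + ((1 - t) * Pk + t * psi_real zt) <=
  (1 - t) * (f x + Pk) + t * F_real xs
  + t ^+ 2 / (2 * T0) * (wnorm2 v (z - xs) - wnorm2 v (zt - xs)).
Proof.
have T0n : T0 != 0 by rewrite gt_eqF.
have eso := q_eso y ((T0^-1 * t) *: (zt - z)).
have e : \sum_S q S * f (y + Defs.restrict ((T0^-1 * t) *: (zt - z)) S) =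
    \sum_S q S * f (xS S).
  apply: eq_bigr => S _; congr (_ * f _); congr (_ + _).
  apply/rowP => i; rewrite restrictE !mxE; case: ifP => // _.
  by rewrite subrr mulr0.
rewrite {}e dotrvZr wnorm2Z in eso.
have prx := one_step_prox.
have c1 := convex_gradient_le xs f_cvx (f_diff y).
have c2 := convex_gradient_le x f_cvx (f_diff y).
have d1 : dotrv (gradient f y) (zt - z) =
    dotrv (gradient f y) (zt - y) - dotrv (gradient f y) (z - y).
  have -> : zt - y = (zt - z) + (z - y) by rewrite addrA subrK.
  by rewrite (dotrvDr _ (zt - z) (z - y)) addrK.
(* By definition of y, t (z - y) = - (1 - t) (x - y). *)
have d2 : t * dotrv (gradient f y) (z - y) =
    - ((1 - t) * dotrv (gradient f y) (x - y)).
  rewrite -!dotrvZr -mulN1r -dotrvZr; congr dotrv.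
  by apply/rowP => i; rewrite /y !mxE; ring.
have {}eso : \sum_S q S * f (xS S) <= f y + t * dotrv (gradient f y) (zt - y)
    + (1 - t) * dotrv (gradient f y) (x - y)
    + t ^+ 2 / (2 * T0) * wnorm2 v (zt - z).
  apply: le_trans eso _; rewrite d1 le_eqVlt; apply/orP; left; apply/eqP.
  have -> : (1 - t) * dotrv (gradient f y) (x - y) =
    - (t * dotrv (gradient f y) (z - y)) by rewrite d2 opprK.
  by field.
move: eso prx c1 c2; rewrite /F_real.
move: (\sum_S _) (dotrv _ (zt - y)) => A d.
move: (dotrv _ (x - y)) (dotrv _ (xs - y)) => dx ds.
move: (wnorm2 v (zt - z)) (wnorm2 v (zt - xs)) (wnorm2 v (z - xs)) => w1 w2 w3.
move: (psi_real zt) (psi_real xs) => pz ps.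
move: (f y) (f x) (f xs) => fy fx fs h1 h2 h3 h4.
have {}h2 := ler_wpM2l (ltW t_gt0) h2.
have {}h3 := ler_wpM2l (ltW t_gt0) h3.
have {}h4 : (1 - t) * (fy + dx) <= (1 - t) * fx.
  by rewrite ler_wpM2l // subr_ge0.
have e k : t ^+ 2 / (2 * T0) * k = t * (t / (2 * T0) * k) by ring.
rewrite !e in h1 *; move: (t / (2 * T0)) h1 h2 => c h1 h2.
lra.
Qed.

(** [sampling_mean] gives a mean change of psi equal to T0 (psi zt - psi z), which the factor t / T0
    turns into t (psi zt - psi z), as in [one_step_objective]. The squared distance likewise drops
    by T0 times its full-update drop, so dividing by t^2 makes the two quadratic differences
    cancel. *)
Lemma one_step :
  \sum_S q S *
    ((t ^+ 2)^-1 * (f (xS S) + ((1 - t) * Pk + t * psi_real z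
       + T0^-1 * t * (psi_real (zS S) - psi_real z)) - F_real xs)
     + (2 * T0 ^+ 2)^-1 * wnorm2 v (zS S - xs)) <=
  (1 - t) / t ^+ 2 * (f x + Pk - F_real xs)
  + (2 * T0 ^+ 2)^-1 * wnorm2 v (z - xs).
Proof.
have T0n : T0 != 0 by rewrite gt_eqF.
have tn : t != 0 by rewrite gt_eqF.
have Epsi : \sum_S q S * psi_real (zS S) =
    T0 * psi_real zt + (1 - T0) * psi_real z.
  rewrite -[RHS]/(_ + _ * \sum_i _) !mulr_sumr -big_split -sampling_mean.
  apply: eq_bigr => S _; congr (_ * _).
  by apply: eq_bigr => i _; rewrite mxE; case: ifP.
have Ew : \sum_S q S * wnorm2 v (zS S - xs) =
    T0 * wnorm2 v (zt - xs) + (1 - T0) * wnorm2 v (z - xs).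
  rewrite /wnorm2 !mulr_sumr -big_split -sampling_mean.
  apply: eq_bigr => S _; congr (_ * _).
  by apply: eq_bigr => i _; rewrite !mxE; case: ifP.
have obj := one_step_objective.
set c := (1 - t) * Pk + t * psi_real z - T0^-1 * t * psi_real z - F_real xs.
have -> : \sum_S q S *
    ((t ^+ 2)^-1 * (f (xS S) + ((1 - t) * Pk + t * psi_real z
       + T0^-1 * t * (psi_real (zS S) - psi_real z)) - F_real xs)
     + (2 * T0 ^+ 2)^-1 * wnorm2 v (zS S - xs)) =
  (t ^+ 2)^-1 * (\sum_S q S * f (xS S))
  + (t ^+ 2)^-1 * c * (\sum_S q S)
  + (t ^+ 2)^-1 * T0^-1 * t * (\sum_S q S * psi_real (zS S))
  + (2 * T0 ^+ 2)^-1 * (\sum_S q S * wnorm2 v (zS S - xs)).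
  rewrite {}/c {obj Epsi}; move: (psi_real z) => pz.
  rewrite !mulr_sumr -!big_split /=; apply: eq_bigr => S _; ring.
rewrite Epsi Ew q_sum1.
have t2 : 0 <= (t ^+ 2)^-1 by rewrite invr_ge0 sqr_ge0.
have := ler_wpM2l t2 obj; rewrite -subr_ge0 => h; rewrite -subr_ge0.
rewrite (_ : _ - _ = (t ^+ 2)^-1 * ((1 - t) * (f x + Pk) + t * F_real xs
  + t ^+ 2 / (2 * T0) * (wnorm2 v (z - xs) - wnorm2 v (zt - xs))) -
  (t ^+ 2)^-1 * (\sum_S q S * f (xS S) + ((1 - t) * Pk + t * psi_real zt))) //.
by rewrite /c; field; rewrite T0n tn.
Qed.

End sampling_weights.

End one_step.

(** * Integration of functions of a finite-valued random variable *)

Section finite_random_variable.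
Context d (Omega : measurableType d) (R : realType) (P : probability Omega R).

Lemma integral_finite_rv (T : finType) (H : Omega -> T) (g : T -> R) :
  (forall h, measurable (H @^-1` [set h])) ->
  (\int[P]_w (g (H w))%:E = (\sum_h g h * fine (P (H @^-1` [set h])))%:E)%E.
Proof.
move=> mH.
have intH h : P.-integrable [set: Omega]
    (fun w => (\1_(H @^-1` [set h]) w)%:E).
  by apply: integrable_indic => //; exact: fin_num_measure.
transitivity (\int[P]_w
    (\sum_h (g h)%:E * (\1_(H @^-1` [set h]) w)%:E))%E.
  apply: eq_integral => w _; rewrite (bigD1 (H w)) //= big1 => [|h hw].
    by rewrite indicE mem_set // mule1 adde0.
  by rewrite indicE memNset ?mule0 // => /= /eqP; rewrite eq_sym (negbTE hw).
rewrite integral_sum //; last by move=> h; exact: integrableZl.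
rewrite -sumEFin; apply: eq_bigr => h _.
rewrite integralZl // integral_indic // setIT EFinM fineK //.
exact: fin_num_measure.
Qed.

End finite_random_variable.

(** * Sampling histories and expectations as finite sums over them *)

Section histories.
Context d (Omega : measurableType d) (R : realType) (P : probability Omega R).
Variables (n : nat) (S : nat -> {RV P >-> {set 'I_n}}).
Local Notation T := {set 'I_n}.
Variable q : T -> R.
Hypothesis q_law : forall k s, P (S k @^-1` [set s]) = (q s)%:E.
Hypothesis S_indep : mutually_independent S.

(* The samplings drawn before iteration k, the most recent one first. *)
Fixpoint hist (k : nat) (w : Omega) : k.-tuple T :=
  if k is k'.+1 then [tuple of S k' w :: hist k' w] else [tuple].

Definition hist_weight (h : seq T) : R := \prod_(s <- h) q s.

Lemma sampling_law_ge0 s : 0 <= q s.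
Proof. by rewrite -lee_fin -(q_law 0). Qed.

Lemma measurable_sampling k s : measurable (S k @^-1` [set s]).
Proof. by rewrite -[_ @^-1` _]setTI; exact: measurable_funP. Qed.

Lemma sampling_law_sum1 : \sum_s q s = 1.
Proof.
have := integral_finite_rv P (fun=> 1) (measurable_sampling 0).
rewrite integral_cst // mul1e => e.
have := probability_setT P; rewrite e => -[].
by under eq_bigr do rewrite mul1r q_law /=.
Qed.

Lemma hist_weight_ge0 h : 0 <= hist_weight h.
Proof. by apply: prodr_ge0 => s _; exact: sampling_law_ge0. Qed.

Lemma histS k w w' :
  hist k.+1 w = hist k.+1 w' -> S k w = S k w' /\ hist k w = hist k w'.
Proof. by move=> /(congr1 val) /= [-> /val_inj ->]. Qed.

Lemma hist_le k i w w' :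
  (i <= k)%N -> hist k w = hist k w' -> hist i w = hist i w'.
Proof.
elim: k => [|k ih]; first by rewrite leqn0 => /eqP ->.
rewrite leq_eqVlt => /orP[/eqP -> //|ik] /histS[_]; exact: ih.
Qed.

(** Draw j is entry j of [rev h], since the latest draw comes first. This cylinder form is the one
    to which independence applies. *)
Lemma hist_preimage k (h : k.-tuple T) :
  hist k @^-1` [set h] =
  \bigcap_(j in [set` [fset j in iota 0 k]%fset])
    (S j @^-1` [set nth finset.set0 (rev h) j]).
Proof.
apply/seteqP; split=> [w /= <- {h} j /=|w hw].
  rewrite !inE mem_iota /= add0n; elim: k => // k ih jk.
  rewrite rev_cons nth_rcons size_rev size_tuple.
  move: jk; rewrite ltnS leq_eqVlt => /orP[/eqP ->|jk].
    by rewrite ltnn eqxx.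
  by rewrite jk ih.
apply/val_inj => /=.
have {}hw j : (j < k)%N -> S j w = nth finset.set0 (rev h) j.
  by move=> jk; apply: hw; rewrite /= !inE mem_iota.
move: (tval h) (size_tuple h) hw => {}h.
elim: k h => [|k ih] [|s h] //= [hk] hw.
congr (_ :: _).
  by rewrite hw // rev_cons nth_rcons size_rev hk ltnn eqxx.
apply: ih => // j jk; rewrite hw; last exact: ltnW.
by rewrite rev_cons nth_rcons size_rev hk jk.
Qed.

Lemma measurable_hist k (h : k.-tuple T) : measurable (hist k @^-1` [set h]).
Proof.
rewrite hist_preimage; apply: fin_bigcap_measurable => [|j _].
  exact: finite_fset.
exact: measurable_sampling.
Qed.

Lemma hist_law k (h : k.-tuple T) :
  P (hist k @^-1` [set h]) = (hist_weight h)%:E.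
Proof.
rewrite hist_preimage S_indep.
under eq_bigr do rewrite q_law.
rewrite prodEFin; congr (_%:E).
rewrite (perm_big (iota 0 k)) /=; last first.
  apply: uniq_perm; rewrite ?fset_uniq ?iota_uniq // => j.
  by rewrite !inE.
rewrite /hist_weight (perm_big (rev h)) /=; last by rewrite perm_sym perm_rev.
rewrite [RHS](big_nth finset.set0) size_rev size_tuple.
by rewrite /index_iota subn0.
Qed.

(* Arbitrary when no outcome has history h, which only happens for histories of
   weight 0. *)
Definition hist_repr k (h : k.-tuple T) : Omega :=
  xget point [set w | hist k w = h].

Lemma hist_reprK k w : hist k (hist_repr (hist k w)) = hist k w.
Proof.
have : [set w' | hist k w' = hist k w] (hist_repr (hist k w)).
  by apply: xgetPex; exists w.
by [].
Qed.

Lemma hist_repr_gt0 k (h : k.-tuple T) :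
  0 < hist_weight h -> hist k (hist_repr h) = h.
Proof.
move=> h0; have [w wh] : (hist k @^-1` [set h]) !=set0.
  apply/set0P; apply: contraTneq h0 => e.
  by rewrite -lte_fin -hist_law e measure0 ltxx.
by rewrite -[in hist_repr h]wh hist_reprK.
Qed.

(* The expectation of those g that are functions of hist k (see
   [integral_hist]); linear and monotone without any measurability condition. *)
Definition Ehist k (g : Omega -> R) : R :=
  \sum_(h : k.-tuple T) hist_weight h * g (hist_repr h).

Definition hist_dep k (U : Type) (g : Omega -> U) : Prop :=
  forall w w', hist k w = hist k w' -> g w = g w'.

Lemma integral_hist k (g : Omega -> R) :
  hist_dep k g -> (\int[P]_w (g w)%:E = (Ehist k g)%:E)%E.
Proof.
move=> gk; pose g' (h : k.-tuple T) := g (hist_repr h).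
transitivity (\int[P]_w (g' (hist k w))%:E)%E.
  by apply: eq_integral => w _; congr (_%:E); apply: gk; rewrite hist_reprK.
rewrite integral_finite_rv; last exact: measurable_hist.
by congr (_%:E); apply: eq_bigr => h _; rewrite hist_law mulrC.
Qed.

Lemma hist_dep_le k i (U : Type) (g : Omega -> U) :
  (i <= k)%N -> hist_dep i g -> hist_dep k g.
Proof. by move=> ik gi w w' /(hist_le ik); exact: gi. Qed.

Lemma Ehist_le_dep k i (g : Omega -> R) :
  (i <= k)%N -> hist_dep i g -> Ehist k g = Ehist i g.
Proof.
move=> ik gi; apply: EFin_inj.
by rewrite -!integral_hist //; exact: hist_dep_le gi.
Qed.

Lemma Ehist_le k (g g' : Omega -> R) :
  (forall w, g w <= g' w) -> Ehist k g <= Ehist k g'.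
Proof.
by move=> gg'; apply: ler_sum => h _; rewrite ler_wpM2l ?hist_weight_ge0.
Qed.

Lemma Ehist_cst k c : Ehist k (fun=> c) = c.
Proof.
apply: EFin_inj; rewrite -integral_hist // integral_cst //.
exact: etrans (congr1 _ (probability_setT P)) (mule1 _).
Qed.

Lemma EhistD k (g g' : Omega -> R) :
  Ehist k (fun w => g w + g' w) = Ehist k g + Ehist k g'.
Proof. by rewrite -big_split; apply: eq_bigr => h _; rewrite mulrDr. Qed.

Lemma EhistZ k c (g : Omega -> R) :
  Ehist k (fun w => c * g w) = c * Ehist k g.
Proof. by rewrite mulr_sumr; apply: eq_bigr => h _; rewrite mulrCA. Qed.

Lemma Ehist_sum k m (g : nat -> Omega -> R) :
  Ehist k (fun w => \sum_(i < m) g i w) = \sum_(i < m) Ehist k (g i).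
Proof.
rewrite /Ehist exchange_big; apply: eq_bigr => h _ /=.
by rewrite mulr_sumr.
Qed.

Lemma EhistS k (g : Omega -> R) :
  Ehist k.+1 g = \sum_(h : k.-tuple T) hist_weight h *
    (\sum_s q s * g (hist_repr [tuple of s :: h])).
Proof.
under [in RHS]eq_bigr do rewrite mulr_sumr.
rewrite pair_big /Ehist /=.
rewrite [LHS](reindex (fun p : k.-tuple T * T => [tuple of p.2 :: p.1])) /=;
    last first.
  exists (fun h : k.+1.-tuple T => ([tuple of behead h], thead h)) =>
      [[h s] _|h _] /=.
    by congr pair; apply/val_inj.
  by rewrite [RHS]tuple_eta.
by apply: eq_bigr => -[h s] _ /=; rewrite /hist_weight big_cons mulrCA mulrA.
Qed.

(** Replaces conditioning on the first k draws: [W s] is an outcome extending the history of w by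
    the draw s. It is constrained only for histories and draws of positive weight, the only ones
    that are certain to be realized by an outcome. *)
Lemma Ehist_step k (g g' : Omega -> R) :
  (forall w (W : T -> Omega), 0 < hist_weight (hist k w) ->
     (forall s, 0 < q s -> S k (W s) = s /\ hist k (W s) = hist k w) ->
     \sum_s q s * g' (W s) <= g w) ->
  Ehist k.+1 g' <= Ehist k g.
Proof.
move=> step; rewrite EhistS; apply: ler_sum => h _.
have [h0|] := ltrP 0 (hist_weight h); last first.
  rewrite le_eqVlt ltNge hist_weight_ge0 orbF => /eqP ->.
  by rewrite !mul0r.
have wh := hist_repr_gt0 h0.
apply: ler_wpM2l; first exact: ltW.
apply: (step _ (fun s => hist_repr [tuple of s :: h])); rewrite wh // => s s0.
have hs : 0 < hist_weight [tuple of s :: h].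
  by rewrite /hist_weight big_cons mulr_gt0.
by have /(congr1 val) /= [-> /val_inj ->] := hist_repr_gt0 hs.
Qed.

End histories.

(** * Convexity of coordinatewise functions and of the weighted norm *)

Section convex_rows.
Variables (R : realType) (n : nat).

Lemma convex_on_coord (i : 'I_n) (D : R -> Prop) (phi : R -> R) :
  convex_on (D : R^o -> Prop) phi ->
  convex_on (fun x : 'rV[R]_n => D (x 0 i)) (fun x => phi (x 0 i)).
Proof. by move=> c t x y t01 Dx Dy; rewrite !mxE; exact: c. Qed.

Lemma wnorm2_ge0 (v x : 'rV[R]_n) : (forall i, 0 < v 0 i) -> 0 <= wnorm2 v x.
Proof.
by move=> v0; apply: sumr_ge0 => i _; rewrite mulr_ge0 ?sqr_ge0 // ltW.
Qed.

Lemma wnorm2_convex (v xs : 'rV[R]_n) : (forall i, 0 < v 0 i) ->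
  convex_on (fun=> True) (fun x => wnorm2 v (x - xs)).
Proof.
move=> v0 t x y t01 _ _.
have c i := convex_on_coord (i := i) (convex_onZ (ltW (v0 i))
  (@convex_on_sqr R (xs 0 i))).
have e u : wnorm2 v (u - xs) = \sum_i v 0 i * (u 0 i - xs 0 i) ^+ 2.
  by apply: eq_bigr => i _; rewrite !mxE.
rewrite !e; split=> //.
by have [_] := @convex_on_sum _ _ _ _ _ c t x y t01 (fun=> I) (fun=> I).
Qed.

End convex_rows.

(** * Indexing of iterations within a phase between restarts *)

Section phases.
Variables (R : realType) (n : nat) (tau : R) (K : nat).

Local Notation vt := (vartheta n tau).
Local Notation th := (theta_restart n tau K).
Local Notation s := (last_restart K).

Lemma last_restart_le k : (s k <= k)%N.
Proof. by elim: k => //= k ih; case: ifP => // _; exact: leqW. Qed.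

Lemma theta_restartE k : th k = vt (k - s k).
Proof.
elim: k => [//|k ih] /=; case: ifP => _; first by rewrite subnn.
by rewrite ih subSn ?last_restart_le.
Qed.

Lemma last_restart_mid k i : (s k <= i <= k)%N -> s i = s k.
Proof.
elim: k => [|k ih]; first by rewrite /= leqn0 => /eqP ->.
rewrite [(i <= k.+1)%N]leq_eqVlt ltnS => /andP[ski /orP[/eqP -> //|ik]].
move: ski => /=; case: ifP => [_|_ ski]; first by rewrite ltnNge ik.
by apply: ih; rewrite ski.
Qed.

(* l stands for the value computed by iteration k before any restart, so that
   the index k - s k + 1 is meaningful even when iteration k restarts. *)
Definition phase_seq (A : Type) (c : nat -> A) (l : A) (k i : nat) : A :=
  if (i <= k - s k)%N then c (s k + i)%N else l.

Lemma phase_seq_last (A : Type) (c : nat -> A) (l : A) k :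
  phase_seq c l k (k - s k).+1 = l.
Proof. by rewrite /phase_seq ltnn. Qed.

Lemma phase_seq_cur (A : Type) (c : nat -> A) (l : A) k :
  phase_seq c l k (k - s k) = c k.
Proof. by rewrite /phase_seq leqnn subnKC ?last_restart_le. Qed.

Lemma phase_seqP (A : Type) (Q : A -> Prop) (c : nat -> A) (l : A) k i :
  (forall i, (s k <= i <= k)%N -> Q (c i)) -> Q l -> Q (phase_seq c l k i).
Proof.
move=> Qc Ql; rewrite /phase_seq; case: ifP => // ik; apply: Qc.
by rewrite leq_addr /= -leq_subRL ?last_restart_le.
Qed.

End phases.

(** * Deterministic estimates along one realization *)

Section trajectory.
Variables (R : realType) (n : nat) (f : 'rV[R]_n -> R).
Variables (psi : 'I_n -> R -> \bar R) (v : 'rV[R]_n) (tau : R).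
Variables (K : nat) (sigma : R) (x0 xs : 'rV[R]_n).

Local Notation T0 := (theta0 n tau).
Local Notation vt := (vartheta n tau).
Local Notation a := (inv_vartheta2_prev n tau).
Local Notation gam := (gamma n tau).
Local Notation th := (theta_restart n tau K).
Local Notation s := (last_restart K).
Local Notation dom := (in_dom psi).
Local Notation Psi := (psi_real psi).
Local Notation F := (F_real f psi).

Definition mix_point (x z : nat -> 'rV[R]_n) k : 'rV[R]_n :=
  (1 - th k) *: x k + th k *: z k.

Definition next_x (x z zp : nat -> 'rV[R]_n) k : 'rV[R]_n :=
  mix_point x z k + (T0^-1 * th k) *: (zp k - z k).

(** Treating the last iterate as one more index of a phase sequence turns the ring point into a
    plain weighted average, to which Jensen's inequality applies. *)
Definition ring_weight k i : R :=
  if (i <= k - s k)%N then gam (k - s k).+1 i * a i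
  else last_weight n tau (k - s k).+1.

Definition ring_point (x z zp : nat -> 'rV[R]_n) k : 'rV[R]_n :=
  (W_coef n tau (k - s k).+1)^-1 *: \sum_(i < (k - s k).+2)
     ring_weight k i *: phase_seq K x (next_x x z zp k) k i.

Definition restart_point (x z zp : nat -> 'rV[R]_n) k : 'rV[R]_n :=
  sigma *: next_x x z zp k + (1 - sigma) *: ring_point x z zp k.

(* Unlike psi (x k), this upper bound of it satisfies the same affine recursion
   as x k (see [psi_hat_nextE]). *)
Definition psi_hat (z : nat -> 'rV[R]_n) k : R :=
  \sum_(i < (k - s k).+1) gam (k - s k) i * Psi (z (s k + i)%N).

Definition psi_hat_next (z zp : nat -> 'rV[R]_n) k : R :=
  \sum_(i < (k - s k).+2) gam (k - s k).+1 i * Psi (phase_seq K z (zp k) k i).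

Definition lyapunov (x z : nat -> 'rV[R]_n) k : R :=
  a (k - s k) * (f (x k) + psi_hat z k - F xs)
  + (2 * T0 ^+ 2)^-1 * wnorm2 v (z k - xs).

(** The value reached by iteration k before a possible restart resets the points and the parameter;
    the one-step inequality concerns this value. *)
Definition lyapunov_next (x z zp : nat -> 'rV[R]_n) k : R :=
  a (k - s k).+1 * (f (next_x x z zp k) + psi_hat_next z zp k - F xs)
  + (2 * T0 ^+ 2)^-1 * wnorm2 v (zp k - xs).

Definition Delta_real (x : 'rV[R]_n) : R :=
  (1 - T0) / T0 ^+ 2 * (F x - F xs) + (2 * T0 ^+ 2)^-1 * wnorm2 v (x - xs).

Hypothesis psiN : forall i t, psi i t != -oo%E.
Hypothesis psi_cvx : forall i, econvex_function (psi i).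
Hypothesis f_cvx : convex_function [set: convex_lmodType 'rV[R]_n] f.
Hypotheses (T0_gt0 : 0 < T0) (T0_le1 : T0 <= 1) (v_gt0 : forall i, 0 < v 0 i).
Hypothesis x0_dom : dom x0.
Hypothesis xs_min : forall x, dom x -> F xs <= F x.
Hypothesis sigma01 : 0 <= sigma <= 1.

Lemma psi_real_convex : convex_on dom Psi.
Proof.
move=> t x y t01 dx dy.
have c i := convex_on_coord (i := i) (@psi_convex_on R n psi psiN psi_cvx i).
exact: (convex_on_sum c t01 dx dy).
Qed.

Lemma F_real_convex : convex_on dom F.
Proof.
move=> t x y t01 dx dy.
have [[_ ?] ?] := convex_onD (convex_on_function f_cvx) psi_real_convex t01
  (conj I dx) (conj I dy).
by [].
Qed.

Lemma Delta_real_convex : convex_on dom Delta_real.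
Proof.
move=> t x y t01 dx dy.
have [dxy Fxy] := F_real_convex t01 dx dy.
have [_ wxy] := @wnorm2_convex _ _ v xs v_gt0 t x y t01 I I.
split=> //; rewrite /Delta_real.
have k1 : 0 <= (1 - T0) / T0 ^+ 2 by rewrite divr_ge0 ?subr_ge0 ?sqr_ge0.
have k2 : 0 <= (2 * T0 ^+ 2)^-1 by rewrite invr_ge0 mulr_ge0 ?sqr_ge0.
have := ler_wpM2l k1 (lerB Fxy (lexx (F xs))).
have := ler_wpM2l k2 wxy.
by move: (wnorm2 _ _) (F _) => w F1; lra.
Qed.

Lemma Delta_real_ge0 x : dom x -> 0 <= Delta_real x.
Proof.
move=> dx; rewrite addr_ge0 // mulr_ge0 ?wnorm2_ge0 ?subr_ge0 ?xs_min //.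
  by rewrite divr_ge0 ?subr_ge0 ?sqr_ge0.
by rewrite invr_ge0 mulr_ge0 ?sqr_ge0.
Qed.

Lemma ring_weight_ge0 k i : 0 <= ring_weight k i.
Proof.
rewrite /ring_weight; case: ifP => _; last exact/ltW/last_weight_gt0.
by rewrite mulr_ge0 ?gamma_ge0 ?inv_vartheta2_prev_ge0.
Qed.

(** At the last index gamma a = 1 / (T0 vartheta) exceeds [last_weight] by (1 - T0) / T0^2, which is
    the coefficient of the objective gap in Delta. *)
Lemma ring_weightE k i : (i < (k - s k).+2)%N ->
  gam (k - s k).+1 i * a i =
  ring_weight k i + (i == (k - s k).+1)%:R * ((1 - T0) / T0 ^+ 2).
Proof.
rewrite /ring_weight [(i < _)%N]ltnS leq_eqVlt => /orP[/eqP ->|].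
  rewrite ltnn eqxx mul1r /last_weight /= subrK gamma_diag //.
  have h := vartheta_neq0 T0_gt0 (k - s k); have h' : T0 != 0 by rewrite gt_eqF.
  by rewrite vartheta0; field; rewrite h h'.
by rewrite ltnS => ik; rewrite ik ltn_eqF // mul0r addr0.
Qed.

Lemma sum_ring_weight k :
  \sum_(i < (k - s k).+2) ring_weight k i = W_coef n tau (k - s k).+1.
Proof.
rewrite W_coefE //; under [in RHS]eq_bigr => i _ do rewrite ring_weightE //.
rewrite big_split /= -addrA [X in _ + X](_ : _ = 0) ?addr0 //.
rewrite big_ord_recr /= eqxx mul1r big1 ?add0r ?subrr // => i _.
by rewrite ltn_eqF ?mul0r.
Qed.

Section realization.
Variables (S : nat -> {set 'I_n}) (x z zp : nat -> 'rV[R]_n).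
Hypothesis H : approx_restart f psi v tau K sigma x0 S x z zp.

Local Notation xp := (next_x x z zp).

Lemma approx_step k :
  [/\ forall i, i \in S k -> is_argmin
        (prox_objective f psi v tau (th k) (mix_point x z k) (z k) i)
        (zp k 0 i),
      forall i, i \notin S k -> zp k 0 i = z k 0 i,
      x k.+1 = (if (K %| k)%N then restart_point x z zp k else xp k) &
      z k.+1 = (if (K %| k)%N then restart_point x z zp k else zp k)].
Proof.
have [h1 h2 h3 h4] := ar_step H k; rewrite subSn ?last_restart_le // in h3 h4.
suff e : restart_point x z zp k = sigma *: (mix_point x z k +
   (n%:R / tau * th k) *: (zp k - z k)) + (1 - sigma) *:
    ((W_coef n tau (k - s k).+1)^-1 *:
      (\sum_(i < (k - s k).+1) (gam (k - s k).+1 i * a i) *: x (s k + i)%N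
       + last_weight n tau (k - s k).+1 *: (mix_point x z k +
   (n%:R / tau * th k) *: (zp k - z k)))).
  by split=> //; rewrite e // h3 /next_x theta0V.
rewrite /restart_point /next_x theta0V; congr (_ + _ *: (_ *: _)).
rewrite big_ord_recr /= {2}/ring_weight ltnn phase_seq_last.
congr (_ + _); apply: eq_bigr => i _.
by rewrite /ring_weight /phase_seq -ltnS ltn_ord.
Qed.

Lemma psi_hat_nextE k : psi_hat_next z zp k =
  (1 - th k) * psi_hat z k + th k * Psi (z k)
  + T0^-1 * th k * (Psi (zp k) - Psi (z k)).
Proof.
rewrite /psi_hat_next theta_restartE.
rewrite (sum_gammaS T0_gt0 (fun i => Psi (phase_seq K z (zp k) k i))).
rewrite phase_seq_last phase_seq_cur; congr (_ * _ + _ + _).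
by apply: eq_bigr => i _; rewrite /phase_seq -ltnS ltn_ord.
Qed.

Lemma next_xE k :
  x k = \sum_(i < (k - s k).+1) gam (k - s k) i *: z (s k + i)%N ->
  xp k = \sum_(i < (k - s k).+2) gam (k - s k).+1 i *: phase_seq K z (zp k) k i.
Proof.
move=> xk; apply/rowP => l; rewrite summxE.
under [RHS]eq_bigr do rewrite mxE.
rewrite (sum_gammaS T0_gt0 (fun i => phase_seq K z (zp k) k i 0 l)).
rewrite phase_seq_last phase_seq_cur -theta_restartE !mxE.
congr (_ * _ + _ + _).
rewrite xk summxE; apply: eq_bigr => i _.
by rewrite mxE /phase_seq -ltnS ltn_ord.
Qed.

Lemma gamma_jensen (D : 'rV[R]_n -> Prop) phi (c : nat -> 'rV[R]_n) j :
  convex_on D phi -> (forall i, (i <= j)%N -> D (c i)) ->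
  D (\sum_(i < j.+1) gam j i *: c i) /\
  phi (\sum_(i < j.+1) gam j i *: c i) <= \sum_(i < j.+1) gam j i * phi (c i).
Proof.
move=> cvx Dc.
have [] := convex_on_jensen (w := gam j) (c := c) (m := j.+1) cvx.
- by move=> i _; exact: gamma_ge0.
- by move=> i; exact: Dc.
- by rewrite sum_gamma1.
by rewrite sum_gamma1 // invr1 scale1r mul1r.
Qed.

Lemma ring_jensen (D : 'rV[R]_n -> Prop) phi k :
  convex_on D phi ->
  (forall i, (s k <= i <= k)%N -> D (x i)) -> D (xp k) ->
  D (ring_point x z zp k) /\
  W_coef n tau (k - s k).+1 * phi (ring_point x z zp k) <=
  \sum_(i < (k - s k).+2) ring_weight k i * phi (phase_seq K x (xp k) k i).
Proof.
move=> cvx Dx Dxp.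
have [] := convex_on_jensen (w := ring_weight k)
  (c := phase_seq K x (xp k) k) (m := (k - s k).+2) cvx.
- by move=> i _; exact: ring_weight_ge0.
- by move=> i _; exact: (phase_seqP (Q := D)).
- by rewrite sum_ring_weight W_coef_gt0.
rewrite sum_ring_weight => Dr pr; split=> //.
by rewrite mulrC -ler_pdivlMr ?W_coef_gt0 // mulrC.
Qed.

Lemma zp_dom k : dom (z k) -> dom (zp k).
Proof.
have [amin same _ _] := approx_step k => dz i.
have [iS|iS] := boolP (i \in S k); last by rewrite same.
by have [] := argmin_prox_real psiN (dz i) (amin i iS).
Qed.

(** The two claims need each other: [xp k] is an extrapolation, with coefficient th - th / T0 <= 0
    on [z k], so it is placed in the domain through its expansion as a convex combination of the
    z's. *)
Lemma trajectory_dom_expand k :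
  (forall i, (i <= k)%N -> dom (x i) /\ dom (z i)) /\
  x k = \sum_(i < (k - s k).+1) gam (k - s k) i *: z (s k + i)%N.
Proof.
elim: k => [|k [dk xk]].
  split; last by rewrite big_ord1 scale1r (ar_x0 H) (ar_z0 H).
  by move=> i; rewrite leqn0 => /eqP ->; rewrite (ar_x0 H) (ar_z0 H).
have [dx dz] := dk _ (leqnn k).
have dzp := zp_dom dz.
have dzeta i : dom (phase_seq K z (zp k) k i).
  by apply: (phase_seqP (Q := dom)) => // j /andP[_ /dk[]].
have dxp : dom (xp k).
  rewrite (next_xE xk); have [//] := gamma_jensen psi_real_convex
    (c := phase_seq K z (zp k) k) (j := (k - s k).+1) (fun i _ => dzeta i).
have dr : dom (restart_point x z zp k).
  have dx' i : (s k <= i <= k)%N -> dom (x i) by move=> /andP[_ /dk[]].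
  have [dr _] := @ring_jensen dom Psi k psi_real_convex dx' dxp.
  by case: (psi_real_convex sigma01 dxp dr).
have [_ _ ex ez] := approx_step k.
split.
  move=> i; rewrite leq_eqVlt => /orP[/eqP ->|]; last by rewrite ltnS => /dk.
  by rewrite ex ez; case: ifP.
rewrite ex /=; case: ifP => Kk.
  by rewrite subnn big_ord1 scale1r addn0 ez Kk.
rewrite (next_xE xk) subSn ?last_restart_le //; apply: eq_bigr => i _.
congr (_ *: _); rewrite /phase_seq; case: ifP => // /negbT ik.
have -> : (i = (k - s k).+1 :> nat)%N.
  by apply/eqP; rewrite eqn_leq -ltnS ltn_ord ltnNge.
by rewrite addnS subnKC ?last_restart_le // ez Kk.
Qed.

Lemma x_dom k : dom (x k).
Proof. by have [/(_ k (leqnn k))[]] := trajectory_dom_expand k. Qed.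
Lemma z_dom k : dom (z k).
Proof. by have [/(_ k (leqnn k))[]] := trajectory_dom_expand k. Qed.

Lemma zeta_dom k i : dom (phase_seq K z (zp k) k i).
Proof.
by apply: (phase_seqP (Q := dom)) => [j _|]; [exact: z_dom|exact/zp_dom/z_dom].
Qed.

Lemma next_x_jensen (D : 'rV[R]_n -> Prop) phi k : convex_on D phi ->
  (forall i, D (phase_seq K z (zp k) k i)) ->
  D (xp k) /\ phi (xp k) <=
    \sum_(i < (k - s k).+2) gam (k - s k).+1 i * phi (phase_seq K z (zp k) k i).
Proof.
move=> cvx Dc; rewrite (next_xE (trajectory_dom_expand k).2).
exact: (gamma_jensen (c := phase_seq K z (zp k) k) cvx).
Qed.

Lemma next_x_dom k : dom (xp k).
Proof. by have [] := next_x_jensen psi_real_convex (zeta_dom k). Qed.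

Lemma ring_point_dom k : dom (ring_point x z zp k).
Proof.
by have [] := ring_jensen psi_real_convex (fun i _ => x_dom i) (next_x_dom k).
Qed.

Lemma psi_hat_ge k : Psi (x k) <= psi_hat z k.
Proof.
rewrite (trajectory_dom_expand k).2.
by have [] := gamma_jensen psi_real_convex (c := fun i => z (s k + i)%N)
  (j := (k - s k)%N) (fun i _ => z_dom _).
Qed.

Lemma lyapunov_ge k : (F (x k) - F xs) * a (k - s k)
  + (2 * T0 ^+ 2)^-1 * wnorm2 v (z k - xs) <= lyapunov x z k.
Proof.
rewrite /lyapunov lerD2r mulrC ler_wpM2l ?inv_vartheta2_prev_ge0 //.
by rewrite lerD2r lerD2l psi_hat_ge.
Qed.

Lemma lyapunov_next_ge k : (F (xp k) - F xs) * a (k - s k).+1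
  + (2 * T0 ^+ 2)^-1 * wnorm2 v (zp k - xs) <= lyapunov_next x z zp k.
Proof.
rewrite /lyapunov_next lerD2r mulrC ler_wpM2l ?inv_vartheta2_prev_ge0 //.
rewrite lerD2r lerD2l.
by have [] := next_x_jensen psi_real_convex (zeta_dom k).
Qed.

(** At a restart x and z coincide, and the index 0 value of [a] is the coefficient (1 - T0) / T0^2
    of Delta. *)
Lemma lyapunov_restart k : s k = k -> lyapunov x z k = Delta_real (x k).
Proof.
move=> sk; have := (trajectory_dom_expand k).2.
rewrite /lyapunov /psi_hat sk subnn !big_ord1 scale1r mul1r addn0 => <-.
by rewrite /= vartheta0.
Qed.

Lemma lyapunov_continue k : ~~ (K %| k)%N ->
  x k.+1 = xp k /\ lyapunov x z k.+1 = lyapunov_next x z zp k.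
Proof.
move=> Kk; have [_ _ ex ez] := approx_step k; rewrite (negbTE Kk) in ex ez.
split=> //; rewrite /lyapunov /lyapunov_next /psi_hat /psi_hat_next /=.
rewrite (negbTE Kk) subSn ?last_restart_le // ex ez.
congr (_ * (_ + _ - _) + _); apply: eq_bigr => i _; congr (_ * Psi _).
rewrite /phase_seq; case: ifP => // /negbT ik.
have -> : (i = (k - s k).+1 :> nat)%N.
  by apply/eqP; rewrite eqn_leq -ltnS ltn_ord ltnNge.
by rewrite addnS subnKC ?last_restart_le.
Qed.

(** Average the lower bounds [lyapunov_ge] and [lyapunov_next_ge] with weights gamma. By
    [ring_weightE] the objective gaps receive the ring weights plus an excess at [xp k]; that excess
    and Jensen's inequality for the squared norm make up Delta at [xp k]. *)
Lemma Delta_next_le k :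
  Delta_real (xp k) + \sum_(i < (k - s k).+2) ring_weight k i *
     (F (phase_seq K x (xp k) k i) - F xs) <=
  \sum_(i < (k - s k).+2) gam (k - s k).+1 i *
     phase_seq K (lyapunov x z) (lyapunov_next x z zp k) k i.
Proof.
have c0 : 0 <= (2 * T0 ^+ 2)^-1 by rewrite invr_ge0 mulr_ge0 ?sqr_ge0.
have [_ w] := next_x_jensen (wnorm2_convex xs v_gt0) (k := k) (fun=> I).
apply: (@le_trans _ _ (\sum_(i < (k - s k).+2) gam (k - s k).+1 i *
   ((F (phase_seq K x (xp k) k i) - F xs) * a i +
    (2 * T0 ^+ 2)^-1 * wnorm2 v (phase_seq K z (zp k) k i - xs)))); last first.
  apply: ler_sum => i _; rewrite ler_wpM2l ?gamma_ge0 //.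
  rewrite /phase_seq; case: ifPn => [ik|ik].
    have sm : (s (s k + i) = s k)%N.
      apply: last_restart_mid.
      by rewrite leq_addr /= -leq_subRL ?last_restart_le.
    by have := lyapunov_ge (s k + i); rewrite sm addKn.
  have -> : (i = (k - s k).+1 :> nat)%N.
    by apply/eqP; rewrite eqn_leq -ltnS ltn_ord ltnNge.
  exact: lyapunov_next_ge.
have -> : \sum_(i < (k - s k).+2) gam (k - s k).+1 i *
   ((F (phase_seq K x (xp k) k i) - F xs) * a i +
    (2 * T0 ^+ 2)^-1 * wnorm2 v (phase_seq K z (zp k) k i - xs)) =
   \sum_(i < (k - s k).+2) ring_weight k i *
     (F (phase_seq K x (xp k) k i) - F xs) +
   (1 - T0) / T0 ^+ 2 * (F (xp k) - F xs) +
   (2 * T0 ^+ 2)^-1 * \sum_(i < (k - s k).+2) gam (k - s k).+1 i *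
     wnorm2 v (phase_seq K z (zp k) k i - xs).
  have -> : (1 - T0) / T0 ^+ 2 * (F (xp k) - F xs) =
     \sum_(i < (k - s k).+2) (i == (k - s k).+1 :> nat)%:R *
       ((1 - T0) / T0 ^+ 2) * (F (phase_seq K x (xp k) k i) - F xs).
    rewrite big_ord_recr big1 /= ?eqxx ?mul1r ?add0r ?phase_seq_last // => i _.
    by rewrite ltn_eqF // !mul0r.
  rewrite mulr_sumr -!big_split; apply: eq_bigr => i _ /=.
  rewrite mulrDr (mulrC (_ - _) (a i)) (mulrA (gam _ _) (a i)).
  rewrite ring_weightE // mulrDl; congr (_ + _).
  by rewrite mulrCA.
rewrite /Delta_real addrC addrA lerD2l.
exact: ler_wpM2l.
Qed.

End realization.

End trajectory.

(** * Expected decrease within a phase and across a restart *)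

Section expected_decrease.
Context d (Omega : measurableType d) (R : realType) (P : probability Omega R).
Variables (n : nat) (f : 'rV[R]_n -> R) (psi : 'I_n -> R -> \bar R).
Variables (v : 'rV[R]_n) (tau : R) (K : nat) (sigma : R) (x0 xs : 'rV[R]_n).
Variables (S : nat -> {RV P >-> {set 'I_n}}) (q : {set 'I_n} -> R).
Variables (x z zp : nat -> Omega -> 'rV[R]_n).

Local Notation T0 := (theta0 n tau).
Local Notation a := (inv_vartheta2_prev n tau).
Local Notation th := (theta_restart n tau K).
Local Notation s := (last_restart K).
Local Notation dom := (in_dom psi).
Local Notation F := (F_real f psi).
Local Notation Psi := (psi_real psi).
Local Notation Del := (Delta_real f psi v tau xs).
Local Notation EE := (Ehist S q).
Local Notation W := (W_coef n tau).
Local Notation V k w := (lyapunov f psi v tau K xs (x ^~ w) (z ^~ w) k).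
Local Notation Vn k w :=
  (lyapunov_next f psi v tau K xs (x ^~ w) (z ^~ w) (zp ^~ w) k).
Local Notation xp k w := (next_x tau K (x ^~ w) (z ^~ w) (zp ^~ w) k).
Local Notation xr k w := (ring_point tau K (x ^~ w) (z ^~ w) (zp ^~ w) k).
Local Notation xb k w :=
  (restart_point tau K sigma (x ^~ w) (z ^~ w) (zp ^~ w) k).

Hypothesis psiN : forall i t, psi i t != -oo%E.
Hypothesis psi_cvx : forall i, econvex_function (psi i).
Hypothesis f_cvx : convex_function [set: convex_lmodType 'rV[R]_n] f.
Hypothesis f_diff : forall y, differentiable f y.
Hypotheses (T0_gt0 : 0 < T0) (T0_le1 : T0 <= 1) (v_gt0 : forall i, 0 < v 0 i).
Hypotheses (x0_dom : dom x0) (xs_dom : dom xs).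
Hypothesis xs_min : forall x, dom x -> F xs <= F x.
Hypothesis sigma01 : 0 <= sigma <= 1.
Hypothesis q_law : forall k A, P (S k @^-1` [set A]) = (q A)%:E.
Hypothesis S_indep : mutually_independent S.
Hypothesis q_marginal :
  forall i : 'I_n, \sum_(A : {set 'I_n} | i \in A) q A = T0.
Hypothesis q_eso : forall x h, \sum_A q A * f (x + Defs.restrict h A) <=
  f x + T0 * (dotrv (gradient f x) h + 2^-1 * wnorm2 v h).
Hypothesis H : forall w, approx_restart f psi v tau K sigma x0
  (fun k => S k w) (x ^~ w) (z ^~ w) (zp ^~ w).

Let step w := approx_step (H w).
Let xdom k w : dom (x k w).
Proof. exact: (x_dom psiN psi_cvx T0_gt0 T0_le1 x0_dom sigma01 (H w)). Qed.

Let zdom k w : dom (z k w).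
Proof. exact: (z_dom psiN psi_cvx T0_gt0 T0_le1 x0_dom sigma01 (H w)). Qed.

Let xpdom k w : dom (xp k w).
Proof. exact: (next_x_dom psiN psi_cvx T0_gt0 T0_le1 x0_dom sigma01 (H w)). Qed.

Let xrdom k w : dom (xr k w).
Proof.
exact: (ring_point_dom psiN psi_cvx T0_gt0 T0_le1 x0_dom sigma01 (H w)).
Qed.

Lemma theta_restart_gt0 k : 0 < th k.
Proof. by rewrite theta_restartE vartheta_gt0. Qed.

Lemma prox_argmin_unique k (y zz : 'rV[R]_n) i (b c : R) :
  (psi i (zz 0%R i) < +oo)%E ->
  is_argmin (prox_objective f psi v tau (th k) y zz i) b ->
  is_argmin (prox_objective f psi v tau (th k) y zz i) c -> b = c.
Proof.
move=> dz /(argmin_prox_real psiN dz)[db bmin].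
move=> /(argmin_prox_real psiN dz)[dc cmin].
apply: (prox_unique _ (@psi_convex_on _ _ _ psiN psi_cvx i) db dc bmin cmin).
have -> : th k * n%:R * v 0 i / (2 * tau) = th k * v 0 i / (2 * T0).
  by rewrite /theta0 !invfM invrK; ring.
apply: divr_gt0; apply: mulr_gt0 => //; exact: theta_restart_gt0.
Qed.

Lemma zp_agree k w w' : S k w = S k w' -> x k w = x k w' -> z k w = z k w' ->
  zp k w = zp k w'.
Proof.
move=> eS ex ez; have [am sm _ _] := step w k; have [am' sm' _ _] := step w' k.
have ey : mix_point tau K (x ^~ w) (z ^~ w) k =
    mix_point tau K (x ^~ w') (z ^~ w') k.
  by rewrite /mix_point ex ez.
rewrite ey ez eS in am sm; apply/rowP => i.
have [iS|iS] := boolP (i \in S k w'); last by rewrite sm // sm'.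
exact: prox_argmin_unique (zdom k w' i) (am i iS) (am' i iS).
Qed.

(** Induction on k through [zp_agree]; this is what justifies computing expectations with
    [Ehist]. *)
Lemma state_agree k w w' : hist S k w = hist S k w' ->
  forall i, (i <= k)%N -> x i w = x i w' /\ z i w = z i w'.
Proof.
elim: k => [_ i|k ih /histS[eS eh] i].
  rewrite leqn0 => /eqP ->.
  by rewrite (ar_x0 (H w)) (ar_x0 (H w')) (ar_z0 (H w)) (ar_z0 (H w')).
rewrite leq_eqVlt => /orP[/eqP ->|]; last by rewrite ltnS => /(ih eh).
have {}ih := ih eh; have [ex ez] := ih k (leqnn k).
have ezp := zp_agree eS ex ez.
have [_ _ -> ->] := step w k; have [_ _ -> ->] := step w' k.
have exp : xp k w = xp k w' by rewrite /next_x /mix_point ex ez ezp.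
suff -> : xb k w = xb k w' by rewrite exp ezp.
rewrite /restart_point /ring_point exp; congr (_ + _ *: (_ *: _)).
apply: eq_bigr => j _; congr (_ *: _); rewrite /phase_seq; case: ifP => // jk.
by have [] := ih (s k + j)%N; rewrite // -leq_subRL ?last_restart_le.
Qed.

Lemma psi_hat_agree k w w' : hist S k w = hist S k w' ->
  psi_hat psi tau K (z ^~ w) k = psi_hat psi tau K (z ^~ w') k.
Proof.
move=> eh; apply: eq_bigr => i _; congr (_ * Psi _).
have [] // := state_agree eh (i := (s k + i)%N).
by rewrite -leq_subRL ?last_restart_le // -ltnS.
Qed.

Lemma lyapunov_dep k : hist_dep S k (fun w => V k w).
Proof.
move=> w w' eh; rewrite /lyapunov (psi_hat_agree eh).
by have [-> ->] := state_agree eh (leqnn k).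
Qed.

Lemma x_dep k : hist_dep S k (x k).
Proof. by move=> w w' eh; have [] := state_agree eh (leqnn k). Qed.

(* All coordinates have a proximal point at a history of positive weight: each
   of them is sampled with positive probability. *)
Lemma lyapunov_step k : EE k.+1 (fun w => Vn k w) <= EE k (fun w => V k w).
Proof.
apply: (Ehist_step q_law S_indep) => w Wf _ WP.
have agree A i : 0 < q A -> (i <= k)%N ->
    x i (Wf A) = x i w /\ z i (Wf A) = z i w.
  by move=> /WP[_ eh]; exact: state_agree.
set y := mix_point tau K (x ^~ w) (z ^~ w) k.
have mixE A : 0 < q A -> mix_point tau K (x ^~ (Wf A)) (z ^~ (Wf A)) k = y.
  by move=> qA; rewrite /mix_point; have [-> ->] := agree A k qA (leqnn k).
have exmin i : exists b,
    is_argmin (prox_objective f psi v tau (th k) y (z k w) i) b.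
  have [A iA qA] : exists2 A : {set 'I_n}, i \in A & 0 < q A.
    apply: contrapT => nex; have := q_marginal i; rewrite big1.
      by move=> e; move: T0_gt0; rewrite -e ltxx.
    move=> A iA; apply/eqP; rewrite eq_le (sampling_law_ge0 q_law) andbT leNgt.
    by apply/negP => qA; apply: nex; exists A.
  exists (zp k (Wf A) 0 i).
  have [+ _ _ _] := step (Wf A) k; rewrite mixE //.
  have [_ ->] := agree A k qA (leqnn k); have [-> _] := WP A qA.
  exact.
have [g gmin] := choice exmin.
pose zt : 'rV[R]_n := \row_i g i.
have ztmin i :
    is_argmin (prox_objective f psi v tau (th k) y (z k w) i) (zt 0 i).
  by rewrite mxE.
have := @one_step _ _ f psi v tau psiN psi_cvx q (sampling_law_sum1 q_law)
  q_marginal f_cvx f_diff T0_gt0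
  q_eso (th k) (x k w) (z k w) zt xs (psi_hat psi tau K (z ^~ w) k)
  (theta_restart_gt0 k) _ xs_dom ztmin.
have th1 : th k <= 1 by rewrite theta_restartE vartheta_le1.
move=> /(_ th1).
set lhs := \sum_A _; set rhs := (X in _ <= X).
have -> : rhs = V k w.
  rewrite /rhs /lyapunov inv_vartheta2_prevS // -theta_restartE /=.
  by rewrite -theta_restartE.
apply: le_trans; rewrite le_eqVlt; apply/orP; left; apply/eqP.
apply: eq_bigr => A _.
(* For a sampling of probability 0 the outcome [Wf A] is unconstrained, but both summands carry the
   factor 0. *)
have [qA|] := ltrP 0 (q A); last first.
  by move=> qA; rewrite (_ : q A = 0) ?mul0r //; apply/eqP;
    rewrite eq_le qA (sampling_law_ge0 q_law).
congr (_ * _); have [eS eh] := WP A qA.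
have [ex ez] := agree A k qA (leqnn k).
have ezp : zp k (Wf A) = \row_i (if i \in A then zt 0 i else z k w 0 i).
  apply/rowP => i; rewrite mxE; have [am sm _ _] := step (Wf A) k.
  rewrite mixE // eS ez in am sm; case: ifPn => [iA|/sm -> //].
  exact: prox_argmin_unique (zdom k w i) (am i iA) (ztmin i).
rewrite /lyapunov_next psi_hat_nextE // (psi_hat_agree eh) /next_x mixE //.
by rewrite ez ezp /= -theta_restartE.
Qed.

Definition restart_gap k : R := EE (s k) (fun w => Del (x (s k) w)).

Lemma lyapunov_le k : EE k (fun w => V k w) <= restart_gap k.
Proof.
have eqr m : s m = m -> EE m (fun w => V m w) <= restart_gap m.
  move=> sm; rewrite /restart_gap sm; apply: Ehist_le => // w.
  by rewrite (lyapunov_restart xs psiN psi_cvx T0_gt0 T0_le1 x0_dom sigma01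
    (H w)).
elim: k => [|k ih]; first exact: eqr.
have [Kk|Kk] := boolP (K %| k)%N; first by apply: eqr; rewrite /= Kk.
have -> : restart_gap k.+1 = restart_gap k.
  by rewrite /restart_gap /= (negbTE Kk).
apply: le_trans ih; apply: le_trans (lyapunov_step k).
apply: Ehist_le => // w.
by have [_ ->] := lyapunov_continue xs (H w) Kk.
Qed.

Lemma phase_gap k i : (s k <= i <= k)%N -> restart_gap i = restart_gap k.
Proof. by move=> ik; rewrite /restart_gap (last_restart_mid ik). Qed.

(** In expectation each Lyapunov value in [Delta_next_le] is at most the gap at the last restart,
    and the gammas sum to 1. *)
Lemma phase_bound k : EE k.+1 (fun w => Del (xp k w)) +
  EE k.+1 (fun w => \sum_(i < (k - s k).+2) ring_weight n tau K k i *
     (F (phase_seq K (x ^~ w) (xp k w) k i) - F xs)) <= restart_gap k.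
Proof.
rewrite -EhistD.
have le1 w := Delta_next_le xs psiN psi_cvx T0_gt0 T0_le1 v_gt0 x0_dom sigma01
  (H w) k.
apply: le_trans (Ehist_le q_law _ le1) _.
rewrite (Ehist_sum S q k.+1 _ (fun i w => gamma n tau (k - s k).+1 i *
  phase_seq K (fun m => V m w) (Vn k w) k i)).
have -> : restart_gap k =
    \sum_(i < (k - s k).+2) gamma n tau (k - s k).+1 i * restart_gap k.
  by rewrite -mulr_suml sum_gamma1 // mul1r.
apply: ler_sum => i _.
rewrite (EhistZ S q k.+1 _ (fun w =>
  phase_seq K (fun m => V m w) (Vn k w) k i)).
rewrite ler_wpM2l ?gamma_ge0 //.
rewrite /phase_seq; case: (leqP i (k - s k)%N) => ik.
  have ik' : (s k <= s k + i <= k)%N.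
    by rewrite leq_addr /= -leq_subRL ?last_restart_le.
  rewrite (Ehist_le_dep q_law S_indep (i := (s k + i)%N)).
  - by rewrite -(phase_gap ik') lyapunov_le.
  - by case/andP: ik' => _ /leqW.
  - exact: lyapunov_dep.
exact: le_trans (lyapunov_step k) (lyapunov_le k).
Qed.

Lemma next_gap_le k : EE k.+1 (fun w => Del (xp k w)) <= restart_gap k.
Proof.
apply: le_trans (phase_bound k); rewrite lerDl.
apply: sumr_ge0 => h _; rewrite mulr_ge0 ?(hist_weight_ge0 q_law) //.
apply: sumr_ge0 => i _; rewrite mulr_ge0 ?ring_weight_ge0 // subr_ge0 xs_min //.
by apply: (phase_seqP (Q := dom)).
Qed.

Lemma gap_le k : EE k (fun w => Del (x k w)) <= restart_gap k.
Proof.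
have eqr m : s m = m -> EE m (fun w => Del (x m w)) <= restart_gap m.
  by move=> sm; rewrite /restart_gap sm.
case: k => [|k]; first exact: eqr.
have [Kk|Kk] := boolP (K %| k)%N; first by apply: eqr; rewrite /= Kk.
have -> : restart_gap k.+1 = restart_gap k.
  by rewrite /restart_gap /= (negbTE Kk).
apply: le_trans (next_gap_le k); apply: Ehist_le => // w.
by have [-> _] := lyapunov_continue xs (H w) Kk.
Qed.

(** Delta is convex and the ring point averages points of the phase, each with expected Delta at
    most the gap. *)
Lemma ring_gap_le k : EE k.+1 (fun w => Del (xr k w)) <= restart_gap k.
Proof.
have W0 := W_coef_gt0 T0_gt0 T0_le1 (k - s k).
rewrite -(ler_pM2l W0) -EhistZ.
have le1 w : W (k - s k).+1 * Del (xr k w) <=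
    \sum_(i < (k - s k).+2) ring_weight n tau K k i *
      phase_seq K (fun m => Del (x m w)) (Del (xp k w)) k i.
  have [_ h] := ring_jensen T0_gt0 T0_le1 (x := x ^~ w) (z := z ^~ w)
    (zp := zp ^~ w)
    (Delta_real_convex (v := v) xs psiN psi_cvx f_cvx T0_le1 v_gt0)
    (fun i _ => xdom i w) (xpdom k w).
  apply: le_trans h _; apply: ler_sum => i _.
  rewrite ler_wpM2l ?ring_weight_ge0 //.
  by rewrite /phase_seq; case: (leqP i (k - s k)%N).
apply: le_trans (Ehist_le q_law _ le1) _.
rewrite (Ehist_sum S q k.+1 _ (fun i w => ring_weight n tau K k i *
      phase_seq K (fun m => Del (x m w)) (Del (xp k w)) k i)).
rewrite -(sum_ring_weight K T0_gt0) mulr_suml.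
apply: ler_sum => i _.
rewrite (EhistZ S q k.+1 _ (fun w =>
  phase_seq K (fun m => Del (x m w)) (Del (xp k w)) k i)).
rewrite ler_wpM2l ?ring_weight_ge0 //.
rewrite /phase_seq; case: (leqP i (k - s k)%N) => ik; last exact: next_gap_le.
have ik' : (s k <= s k + i <= k)%N.
  by rewrite leq_addr /= -leq_subRL ?last_restart_le.
rewrite (Ehist_le_dep q_law S_indep (i := (s k + i)%N)).
- by rewrite -(phase_gap ik') gap_le.
- by case/andP: ik' => _ /leqW.
- by move=> w w' /x_dep ->.
Qed.

(** Convexity splits Delta of the restart point into sigma Delta(xp) and (1 - sigma) Delta(xr). The
    fraction lam of the second part is paid for by sigma times the ring-weighted gaps in
    [phase_bound]; the remaining fraction uses [ring_gap_le]. Keeping lam free lets lam = 0 cover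
    phases of other lengths than K. *)
Lemma restart_gap_next k (lam : R) : (K %| k)%N -> 0 <= lam <= 1 ->
  (forall y, dom y -> (1 - sigma) * (lam * Del y) <=
     sigma * (W (k - s k).+1 * (F y - F xs))) ->
  restart_gap k.+1 <= (1 - lam * (1 - sigma)) * restart_gap k.
Proof.
move=> Kk /andP[lam0 lam1] hlam; have /andP[s0 s1] := sigma01.
have lam1' : 0 <= 1 - lam by rewrite subr_ge0.
have s1' : 0 <= 1 - sigma by rewrite subr_ge0.
pose RW w := \sum_(i < (k - s k).+2) ring_weight n tau K k i *
     (F (phase_seq K (x ^~ w) (xp k w) k i) - F xs).
rewrite /restart_gap /= Kk -/(restart_gap k).
have le1 w : Del (x k.+1 w) <= sigma * Del (xp k w) + sigma * RW w +
    (1 - sigma) * (1 - lam) * Del (xr k w).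
  have [_ _ -> _] := step w k; rewrite Kk.
  have [_ h] := Delta_real_convex xs psiN psi_cvx f_cvx T0_le1 v_gt0 sigma01
    (xpdom k w) (xrdom k w).
  apply: le_trans h _; rewrite -addrA lerD2l.
  have -> : (1 - sigma) * Del (xr k w) = (1 - sigma) * (lam * Del (xr k w)) +
    (1 - sigma) * (1 - lam) * Del (xr k w) by ring.
  rewrite lerD2r; apply: le_trans (hlam _ (xrdom k w)) _.
  rewrite ler_wpM2l // /RW.
  have [_ h] := ring_jensen T0_gt0 T0_le1 (x := x ^~ w) (z := z ^~ w)
    (zp := zp ^~ w) (F_real_convex psiN psi_cvx f_cvx)
    (fun i _ => xdom i w) (xpdom k w).
  under [leRHS]eq_bigr do rewrite mulrBr.
  by rewrite sumrB -mulr_suml sum_ring_weight // mulrBr lerD2r.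
apply: le_trans (Ehist_le q_law _ le1) _.
rewrite !EhistD !EhistZ -mulrDr.
have -> : (1 - lam * (1 - sigma)) * restart_gap k = sigma * restart_gap k +
  (1 - sigma) * (1 - lam) * restart_gap k by ring.
apply: lerD; first by rewrite ler_wpM2l // phase_bound.
by rewrite ler_wpM2l ?mulr_ge0 // ring_gap_le.
Qed.

End expected_decrease.

(** * Consequences of the choice of K *)

Section restart_period.
Variables (R : realType) (n : nat) (tau mu : R) (K : nat).
Local Notation T0 := (theta0 n tau).
Hypotheses (T0_gt0 : 0 < T0) (T0_le1 : T0 <= 1) (mu_gt0 : 0 < mu).
Hypothesis K_ceil : K%:Z = Num.ceil
  (2 * Num.sqrt 3 / T0 * Num.sqrt (1 + 1 / mu) - 2 / T0 + 1).

Let r : R := 2 * Num.sqrt 3 / T0 * Num.sqrt (1 + 1 / mu).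

Lemma restart_period_sqr : r ^+ 2 = 12 * (1 + 1 / mu) / T0 ^+ 2.
Proof.
rewrite /r; move: (theta0 n tau) T0_gt0 => t t0.
rewrite !exprMn exprVn !sqr_sqrtr //; last first.
  by rewrite addr_ge0 // divr_ge0 // ltW.
by field; rewrite !gt_eqF.
Qed.

(** Compare squares: 12 (1 + 1 / mu) > 4. This makes K positive. *)
Lemma restart_period_gt : 2 / T0 < r.
Proof.
have r0 : 0 <= r by rewrite !mulr_ge0 ?sqrtr_ge0 ?invr_ge0 ?(ltW T0_gt0).
have t0 : 0 <= 2 / T0 by rewrite divr_ge0 // ltW.
rewrite -ltr_sqr ?nnegrE // restart_period_sqr expr_div_n.
rewrite ltr_pM2r ?invr_gt0 ?exprn_gt0 //.
have : 0 < 1 / mu by rewrite divr_gt0.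
lra.
Qed.

Lemma restart_period_ge : r - 2 / T0 + 1 <= K%:R.
Proof. by rewrite -[K%:R]/(K%:Z%:~R) K_ceil ceil_ge. Qed.

Lemma restart_period_gt0 : (0 < K)%N.
Proof.
have := restart_period_ge; have := restart_period_gt.
by case: (K) => // h1 h2; lra.
Qed.

(** Rounding up adds less than 1, so K < r - 2 / T0 + 2, and T0 <= 1. *)
Lemma restart_period_le : K%:R <= r.
Proof.
have : (K%:Z - 1)%:~R < r - 2 / T0 + 1 by rewrite K_ceil ceilB1_lt.
rewrite intrB /=; have : 1 <= T0^-1 by rewrite invf_ge1.
by rewrite -[K%:Z%:~R]/(K%:R : R); lra.
Qed.

(** The shift - 2 / T0 + 1 in K is such that [vartheta_inv_ge] at K - 1 gives 1 / vartheta_{K-1} >=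
    r / 2. Then the gamma sum is at least r^2 / 12 = (1 + 1 / mu) / T0^2, from which [W_coefE]
    subtracts (1 - T0) / T0^2. *)
Lemma W_coef_period_ge : 1 / mu + T0 <= T0 ^+ 2 * W_coef n tau K.
Proof.
have h1 := restart_period_ge; have := restart_period_gt0.
case: (K) h1 => // j h1 _.
have T0n : T0 != 0 by rewrite gt_eqF.
have r0 : 0 <= r by rewrite !mulr_ge0 ?sqrtr_ge0 ?invr_ge0 ?(ltW T0_gt0).
have h2 := vartheta_inv_ge T0_gt0 j.
have h3 : r / 2 <= (vartheta n tau j)^-1.
  by apply: le_trans h2; move: h1; rewrite -[j.+1%:R]natr1; lra.
have h4 : r ^+ 2 / 4 <= (vartheta n tau j)^-1 ^+ 2.
  have -> : r ^+ 2 / 4 = (r / 2) ^+ 2 by field.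
  by rewrite ler_sqr ?nnegrE ?(le_trans _ h3) // divr_ge0.
have := sum_gamma_inv_ge T0_gt0 T0_le1 j.+1; rewrite /= -exprVn => h5.
rewrite W_coefE // mulrBr.
have h6 : T0 ^+ 2 * (r ^+ 2 / 12) = 1 + 1 / mu.
  by rewrite restart_period_sqr; field; rewrite !gt_eqF.
have h7 : r ^+ 2 / 12 <= \sum_(i < j.+2) gamma n tau j.+1 i *
    inv_vartheta2_prev n tau i by apply: le_trans h5; lra.
have := ler_wpM2l (sqr_ge0 T0) h7; rewrite h6 mulrCA mulfV ?expf_neq0 // mulr1.
lra.
Qed.

Lemma restart_rate_exponent :
  T0 * Num.sqrt mu / (2 * Num.sqrt 3 * Num.sqrt (1 + mu)) = r^-1.
Proof.
have -> : 1 + mu = mu * (1 + 1 / mu) by field; rewrite gt_eqF.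
rewrite sqrtrM ?ltW // /r.
have h3 : Num.sqrt 3 != 0 :> R by rewrite gt_eqF // sqrtr_gt0.
have hm : Num.sqrt mu != 0 by rewrite gt_eqF // sqrtr_gt0.
have h1 : Num.sqrt (1 + 1 / mu) != 0.
  by rewrite gt_eqF // sqrtr_gt0 addr_gt0 // divr_gt0.
have hT : T0 != 0 by rewrite gt_eqF.
by move: (Num.sqrt _) h1 => s s0; field; rewrite h3 hm s0 hT.
Qed.

(** The exponent is k / r - 1 with K <= r, and k <= K ((k - 1) div K + 1). The quotient (k - 1) div
    K counts the phases of length K completed by time k. *)
Lemma restart_rate_exponent_le k : (0 < k)%N ->
  k%:R * T0 * Num.sqrt mu / (2 * Num.sqrt 3 * Num.sqrt (1 + mu)) - 1 <=
  ((k.-1 %/ K)%N)%:R.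
Proof.
move=> k0; rewrite -2!(mulrA k%:R) restart_rate_exponent.
have K0 : (0 < K)%N := restart_period_gt0.
have r0 : 0 < r by rewrite (lt_le_trans _ restart_period_le) // ltr0n.
rewrite lerBlDr ler_pdivrMr // natr1.
apply: le_trans (ler_wpM2l (ler0n _ _) restart_period_le).
by rewrite -natrM ler_nat; have := ltn_ceil k.-1 K0; rewrite prednK.
Qed.

End restart_period.

(** * The law of the sampling and its marginals *)

Section sampling_law.
Context d (Omega : measurableType d) (R : realType) (P : probability Omega R).
Variables (n : nat) (Shat : {RV P >-> {set 'I_n}}) (tau : R).
Local Notation T := {set 'I_n}.

Definition sampling_law (A : T) : R := fine (P (Shat @^-1` [set A])).

Lemma measurable_sampling_preimage (B : set T) : measurable (Shat @^-1` B).
Proof. by rewrite -[_ @^-1` _]setTI; exact: measurable_funP. Qed.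

Lemma sampling_lawE A : P (Shat @^-1` [set A]) = (sampling_law A)%:E.
Proof.
by rewrite fineK // fin_num_measure //; exact: measurable_sampling_preimage.
Qed.

Lemma expectation_sampling (g : T -> R) :
  ('E_P[fun w => g (Shat w)] = (\sum_A sampling_law A * g A)%:E)%E.
Proof.
rewrite unlock (integral_finite_rv P g); last first.
  by move=> A; exact: measurable_sampling_preimage.
by congr (_%:E); apply: eq_bigr => A _; rewrite mulrC.
Qed.

Lemma sampling_marginal i :
  P [set w | i \in Shat w] = (\sum_(A : T | i \in A) sampling_law A)%:E.
Proof.
have mE : measurable [set w | i \in Shat w].
  exact: (measurable_sampling_preimage [set A : T | i \in A]).
rewrite -expectation_indic //.
have -> : \1_[set w | i \in Shat w] = (fun w => (i \in Shat w)%:R : R).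
  by apply/funext => w; rewrite indicE; congr (nat_of_bool _)%:R;
    apply/idP/idP; rewrite inE.
rewrite (expectation_sampling (fun A => (i \in A)%:R)); congr (_%:E).
rewrite [RHS]big_mkcond; apply: eq_bigr => A _.
by case: ifP; rewrite ?mulr1 ?mulr0.
Qed.

Hypothesis unif : uniform_sampling Shat.
Hypothesis mean_size : ('E_P[fun w => (#|Shat w|%:R)%R] = tau%:E)%E.
Hypothesis tau_gt0 : 0 < tau.

Lemma sampling_mean_size :
  tau = \sum_i \sum_(A : T | i \in A) sampling_law A.
Proof.
have := mean_size; rewrite (expectation_sampling (fun A => #|A|%:R)) => -[<-].
rewrite (exchange_big_dep predT) //=; apply: eq_bigr => A _.
by rewrite sumr_const mulr_natr.
Qed.

Lemma sampling_size_gt0 : (0 < n)%N.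
Proof.
rewrite lt0n; apply/eqP => n0; move: tau_gt0.
rewrite sampling_mean_size big1 ?ltxx //.
by move=> i; have := ltn_ord i; rewrite {2}n0.
Qed.

Lemma sampling_marginal_theta0 i :
  \sum_(A : T | i \in A) sampling_law A = theta0 n tau.
Proof.
have n0 : n%:R != 0 :> R by rewrite pnatr_eq0 -lt0n sampling_size_gt0.
apply: (mulIf n0); rewrite /theta0 mulfVK // sampling_mean_size mulr_natr.
rewrite -[X in _ *+ X]card_ord -sumr_const; apply: eq_bigr => j _.
by apply: EFin_inj; rewrite -!sampling_marginal.
Qed.

Lemma sampling_theta0_gt0 : 0 < theta0 n tau.
Proof. by rewrite divr_gt0 // ltr0n sampling_size_gt0. Qed.

Lemma sampling_theta0_le1 : theta0 n tau <= 1.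
Proof.
have i : 'I_n := Ordinal sampling_size_gt0.
rewrite -(sampling_marginal_theta0 i) -lee_fin -sampling_marginal.
apply: probability_le1.
exact: (measurable_sampling_preimage [set A : T | i \in A]).
Qed.

End sampling_law.

(** * Scalar inequalities behind the choice of sigma *)

(** Since 1 - sigma = sigma m and W G = m ((1 - t) + 1 / mu) G / t^2, the claim splits in two: the
    objective part uses lam <= 1, the distance part uses lam <= muF / mu with strong convexity. *)
Lemma restart_contraction (R : realFieldType) (mu muF t W G w lam m sigma : R) :
  0 < mu -> 0 < muF -> 0 < t -> t <= 1 -> 0 <= W -> 0 <= G -> 0 <= w ->
  lam = Num.min (muF / mu) 1 -> m = mu * t ^+ 2 / (1 + mu * (1 - t)) * W ->
  sigma = 1 / (1 + m) -> muF / 2 * w <= G ->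
  (1 - sigma) * (lam * ((1 - t) / t ^+ 2 * G + (2 * t ^+ 2)^-1 * w)) <=
  sigma * (W * G).
Proof.
move=> mu0 muF0 t0 t1 W0 G0 w0 lamE mE sE hw.
have lam1 : lam <= 1 by rewrite lamE ge_min lexx orbT.
have lammu : lam <= muF / mu by rewrite lamE ge_min lexx.
have d0 : 0 < 1 + mu * (1 - t) by rewrite ltr_wpDr // mulr_ge0 ?subr_ge0 // ltW.
have m0 : 0 <= m.
  by rewrite mE mulr_ge0 // divr_ge0 ?(ltW d0) // mulr_ge0 ?sqr_ge0 // ltW.
have m1 : 0 < 1 + m by rewrite ltr_wpDr.
have s0 : 0 <= sigma by rewrite sE divr_ge0 // ltW.
have es : 1 - sigma = sigma * m by rewrite sE; field; rewrite gt_eqF.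
rewrite es -(mulrA sigma m) ler_wpM2l //.
have t2 : 0 < t ^+ 2 by rewrite exprn_gt0.
have -> : W * G = m * ((1 - t + 1 / mu) / t ^+ 2 * G).
  by rewrite mE; field; rewrite !gt_eqF.
rewrite ler_wpM2l //.
have h1 : lam * ((1 - t) / t ^+ 2 * G) <= (1 - t) / t ^+ 2 * G.
  by rewrite ler_piMl // mulr_ge0 // divr_ge0 ?subr_ge0 // ltW.
have h2 : lam * ((2 * t ^+ 2)^-1 * w) <= 1 / mu / t ^+ 2 * G.
  have -> : lam * ((2 * t ^+ 2)^-1 * w) = (t ^+ 2)^-1 * (lam * (w / 2)).
    by field; rewrite gt_eqF.
  have -> : 1 / mu / t ^+ 2 * G = (t ^+ 2)^-1 * (1 / mu * G).
    by field; rewrite !gt_eqF.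
  apply: ler_wpM2l; first by rewrite invr_ge0 ltW.
  apply: (@le_trans _ _ (muF / mu * (w / 2))).
    by rewrite ler_wpM2r // divr_ge0.
  have -> : muF / mu * (w / 2) = 1 / mu * (muF / 2 * w).
    by field; rewrite gt_eqF.
  by rewrite ler_wpM2l // divr_ge0 // ltW.
by rewrite mulrDr (mulrDl (1 - t)) (mulrDl ((1 - t) / _)) lerD.
Qed.

(** The bound on W gives m (1 + mu (1 - t)) >= 1 + mu t. As 1 - sigma = m / (1 + m), the denominator
    2 + mu arises as the sum of 1 + mu (1 - t) and 1 + mu t. *)
Lemma restart_rate_le (R : realFieldType) (mu t W m sigma : R) :
  0 < mu -> 0 < t -> t <= 1 -> 1 / mu + t <= t ^+ 2 * W ->
  m = mu * t ^+ 2 / (1 + mu * (1 - t)) * W -> sigma = 1 / (1 + m) ->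
  (1 + mu * t) / (2 + mu) <= 1 - sigma.
Proof.
move=> mu0 t0 t1 hW mE sE.
have d0 : 0 < 1 + mu * (1 - t) by rewrite ltr_wpDr // mulr_ge0 ?subr_ge0 // ltW.
have hm : 1 + mu * t <= m * (1 + mu * (1 - t)).
  have -> : m * (1 + mu * (1 - t)) = mu * (t ^+ 2 * W).
    by rewrite mE; field; rewrite gt_eqF.
  have -> : 1 + mu * t = mu * (1 / mu + t) by field; rewrite gt_eqF.
  by rewrite ler_wpM2l // ltW.
have m0 : 0 < m.
  rewrite -(pmulr_lgt0 _ d0); apply: lt_le_trans hm.
  by rewrite ltr_wpDr // mulr_ge0 // ltW.
have m1 : 0 < 1 + m by rewrite ltr_wpDr // ltW.
have -> : 1 - sigma = m / (1 + m) by rewrite sE; field; rewrite gt_eqF.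
rewrite ler_pdivrMr ?addr_gt0 // mulrAC ler_pdivlMr //.
have : m * (1 + mu * (1 - t)) = m * (2 + mu) - m * (1 + mu * t) by ring.
have -> : (1 + mu * t) * (1 + m) = (1 + mu * t) + m * (1 + mu * t) by ring.
by move=> e; rewrite -lerBrDr -e.
Qed.

(** * Induction over the phases and the final rate *)

Theorem proposition5 (R : realType) (n : nat)
  (f : 'rV[R]_n -> R) (psi : 'I_n -> R -> \bar R)
  (v : 'rV[R]_n) (xstar : 'rV[R]_n) (muF : R)
  (d : measure_display) (Omega : measurableType d) (P : probability Omega R)
  (Shat : {RV P >-> {set 'I_n}}) (tau : R)
  (Ssamp : nat -> {RV P >-> {set 'I_n}})
  (mu : R) (K : nat) (x0 : 'rV[R]_n)
  (x z zp : nat -> Omega -> 'rV[R]_n) :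
  let F := composite f psi in
  let theta0 := theta0 n tau in
  let sigma := 1 / (1 + m_coef n tau K mu) in
  let Delta := Delta F v theta0 xstar in
  convex_function [set: convex_lmodType 'rV[R]_n] f ->
  (forall y, differentiable f y) ->
  (forall i t, psi i t != -oo%E) ->
  (forall i, closed_function (psi i)) ->
  (forall i, econvex_function (psi i)) ->
  is_argmin F xstar ->
  (forall i, 0 < v 0 i) ->
  0 < muF ->
  (forall y, F xstar + (muF / 2 * wnorm2 v (y - xstar))%:E <= F y)%E ->
  uniform_sampling Shat ->
  ('E_P[fun w => (#|Shat w|%:R)%R] = tau%:E)%E ->
  0 < tau ->
  expected_separable_overapproximation f v tau Shat ->
  (forall k A, distribution P (Ssamp k) A = distribution P Shat A) ->
  mutually_independent Ssamp ->
  0 < mu <= 1 ->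
  K%:Z = Num.ceil (2 * Num.sqrt 3 / theta0 * Num.sqrt (1 + 1 / mu)
                   - 2 / theta0 + 1) ->
  x0 \in edom (separable psi) ->
  (forall w, approx_restart f psi v tau K sigma x0
     (fun k => Ssamp k w) (x ^~ w) (z ^~ w) (zp ^~ w)) ->
  forall k, (K <= k)%N ->
    (\int[P]_w Delta (x k w) <=
     ((1 - Num.min (muF / mu) 1 * ((1 + mu * theta0) / (2 + mu)))
       `^ (k%:R * theta0 * Num.sqrt mu
           / (2 * Num.sqrt 3 * Num.sqrt (1 + mu)) - 1))%:E
     * Delta x0)%E.
Proof.
move=> F t0 sigma Del f_cvx f_diff psiN _ psi_cvx xs_argmin v_gt0 muF_gt0.
move=> strong unif mean_size tau_gt0 eso S_law S_indep /andP[mu_gt0 mu_le1].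
move=> K_ceil x0_edom H k Kk.
have T0_gt0 : 0 < t0 := sampling_theta0_gt0 mean_size tau_gt0.
have T0_le1 : t0 <= 1 := sampling_theta0_le1 unif mean_size tau_gt0.
pose q := sampling_law Shat.
have q_law j A : P (Ssamp j @^-1` [set A]) = (q A)%:E.
  by rewrite -sampling_lawE; exact: S_law.
have q_marginal : forall i, \sum_(A : {set 'I_n} | i \in A) q A = t0 :=
  sampling_marginal_theta0 unif mean_size tau_gt0.
have q_eso y h : \sum_A q A * f (y + Defs.restrict h A) <=
    f y + t0 * (dotrv (gradient f y) h + 2^-1 * wnorm2 v h).
  rewrite -lee_fin.
  rewrite -(expectation_sampling _ (fun A => f (y + Defs.restrict h A))).
  exact: eso.
have x0_dom : in_dom psi x0.
  by apply: (separable_lty psiN); move: x0_edom; rewrite inE.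
have xs_dom : in_dom psi xstar.
  apply: (separable_lty psiN); have := xs_argmin x0.
  rewrite /F (composite_real f psiN x0_dom) /composite => h.
  by rewrite ltey; apply: contraTneq h => ->; rewrite addey // -ltNge ltry.
have xs_min y : in_dom psi y -> F_real f psi xstar <= F_real f psi y.
  by move=> dy; rewrite -lee_fin -!composite_real.
have strong_real y : in_dom psi y ->
    muF / 2 * wnorm2 v (y - xstar) <= F_real f psi y - F_real f psi xstar.
  move=> dy; have := strong y.
  by rewrite /F !composite_real // -EFinD lee_fin -lerBrDl.
have K0 : (0 < K)%N := restart_period_gt0 T0_gt0 mu_gt0 K_ceil.
have W0 : 0 < W_coef n tau K by rewrite -(prednK K0) W_coef_gt0.
have sigma01 : 0 <= sigma <= 1.
  have m0 : 0 <= m_coef n tau K mu.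
    rewrite /m_coef mulr_ge0 ?(ltW W0) // divr_ge0 //.
      by rewrite mulr_ge0 ?sqr_ge0 // ltW.
    by rewrite addr_ge0 // mulr_ge0 ?subr_ge0 // ltW.
  have m1 : 0 < 1 + m_coef n tau K mu by rewrite ltr_wpDr.
  by rewrite /sigma div1r invr_ge0 invf_le1 // lerDl m0 ltW.
set lam := Num.min (muF / mu) 1.
have lam01 : 0 <= lam <= 1.
  by rewrite /lam le_min ler01 ge_min lexx orbT !andbT divr_ge0 // ltW.
set c := (1 + mu * t0) / (2 + mu).
have c_le : c <= 1 - sigma.
  apply: (restart_rate_le mu_gt0 T0_gt0 T0_le1 _ erefl erefl).
  exact: W_coef_period_ge.
have c_lt1 : c < 1.
  rewrite /c ltr_pdivrMr ?addr_gt0 // mul1r.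
  have : mu * t0 <= mu by rewrite ler_piMr // ltW.
  lra.
have c_ge0 : 0 <= c.
  by rewrite divr_ge0 ?addr_ge0 ?mulr_ge0 // ltW.
set rho := 1 - lam * c.
have /andP[lam0 lam1] := lam01.
(* Positivity makes powers of rho nonincreasing in the exponent even for negative exponents, which
   can occur when k is close to K. *)
have rho01 : 0 < rho <= 1.
  rewrite /rho subr_gt0 gerBl mulr_ge0 // andbT.
  by apply: le_lt_trans c_lt1; rewrite ler_piMl.
pose gap := restart_gap f psi v tau K xstar Ssamp q x.
have xdom j w : in_dom psi (x j w).
  exact: (x_dom psiN psi_cvx T0_gt0 T0_le1 x0_dom sigma01 (H w)).
have gap0 : gap 0%N = Delta_real f psi v tau xstar x0.
  rewrite -[RHS](Ehist_cst q_law S_indep 0); congr Ehist.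
  by apply/funext => w; rewrite /= (ar_x0 (H w)).
have gap_ge0 j : 0 <= gap j.
  apply: sumr_ge0 => h _; rewrite mulr_ge0 ?(hist_weight_ge0 q_law) //.
  exact: Delta_real_ge0.
have gap_next := restart_gap_next psiN psi_cvx f_cvx f_diff T0_gt0 T0_le1 v_gt0
  x0_dom xs_dom xs_min sigma01 q_law S_indep q_marginal q_eso H.
have rate j : (0 < j)%N ->
    last_restart K j = (K * (j.-1 %/ K)).+1 /\
    gap j <= rho ^+ (j.-1 %/ K) * Delta_real f psi v tau xstar x0.
  elim: j => // j ih _; case: j ih => [_|j /(_ isT)[sj gj]].
    rewrite /= dvdn0 div0n muln0; split=> //; rewrite expr0 mul1r -gap0.
    (* As K divides 0, the first phase consists of iteration 0 alone; lam = 0 yields that it does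
       not increase the gap. *)
    have := @gap_next 0%N 0 (dvdn0 _); rewrite mul0r subr0 mul1r; apply.
      by rewrite lexx ler01.
    move=> y dy; rewrite mul0r mulr0; case/andP: sigma01 => s0 _.
    apply: mulr_ge0 => //; apply: mulr_ge0; first exact/ltW/W_coef_gt0.
    by rewrite subr_ge0 xs_min.
  have [Kj|Kj] := boolP (K %| j.+1)%N; last first.
    have e : (j.+1 %/ K = j %/ K)%N by rewrite divnS // (negbTE Kj).
    rewrite [j.+2.-1]/= e; split; first by rewrite -sj /= (negbTE Kj).
    by move: gj; rewrite /gap /restart_gap /= (negbTE Kj).
  have e : (j.+1 %/ K = (j %/ K).+1)%N by rewrite divnS // Kj.
  rewrite [j.+2.-1]/= e; split.
    by rewrite [LHS]/= Kj -e mulnC divnK.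
  (* Every later phase has exactly K iterations, so the weight at the restart is the one from which
     sigma was built. *)
  have age : (j.+1 - last_restart K j.+1).+1 = K.
    have hj : j.+1 = (K + K * (j %/ K))%N by rewrite -mulnS -e mulnC divnK.
    by rewrite sj [j.+1.-1]/= hj subnS addnK prednK.
  have step := gap_next j.+1 lam Kj lam01 _.
  apply: (@le_trans _ _ ((1 - lam * (1 - sigma)) * gap j.+1)).
    apply: step => y dy; rewrite age.
    apply: (restart_contraction mu_gt0 muF_gt0 T0_gt0 T0_le1 (ltW W0) _ _ erefl
      erefl erefl (strong_real y dy)); first by rewrite subr_ge0 xs_min.
    exact: wnorm2_ge0.
  rewrite exprS -mulrA; apply: (@le_trans _ _ (rho * gap j.+1)).
    by rewrite ler_wpM2r // lerD2l lerN2 ler_wpM2l.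
  by rewrite ler_wpM2l //; case/andP: rho01 => /ltW.
have k0 : (0 < k)%N := leq_trans K0 Kk.
have DelE y : in_dom psi y -> Del y = (Delta_real f psi v tau xstar y)%:E.
  by move=> dy; rewrite /Del /Delta /F !composite_real.
rewrite (eq_integral (fun w => (Delta_real f psi v tau xstar (x k w))%:E));
    last first.
  by move=> w _; exact: DelE.
rewrite (integral_hist (k := k) q_law S_indep
  (g := fun w => Delta_real f psi v tau xstar (x k w))); last first.
  move=> w w' eh; congr (Delta_real _ _ _ _ _ _).
  exact: (x_dep psiN psi_cvx T0_gt0 T0_le1 v_gt0 x0_dom sigma01 H eh).
rewrite DelE // -EFinM lee_fin.
have [_ gk] := rate k k0.
apply: le_trans (gap_le psiN psi_cvx f_cvx f_diff T0_gt0 T0_le1 v_gt0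
  x0_dom xs_dom xs_min sigma01 q_law S_indep q_marginal q_eso H k) _.
apply: le_trans gk _; rewrite ler_wpM2r ?Delta_real_ge0 //.
rewrite -powR_mulrn; last by case/andP: rho01 => /ltW.
apply: ger_powR => //.
exact: restart_rate_exponent_le.
Qed.
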